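(* Let $\Lambda\subset\mathbb R\times\widehat{\mathbb R}\cong\mathbb R^2$ be a lattice, let $v(x,\omega)=(1+x^2+\omega^2)^{1/2}$ on $\mathbb R^2$, and let $c((x,\omega),(y,\eta))=e^{-2\pi i\eta x}$. Let $\partial_1,\partial_2$ be the densely defined operators $\partial_1:(a(x,\omega))_{(x,\omega)\in\Lambda}\mapsto(2\pi i x\,a(x,\omega))_{(x,\omega)\in\Lambda}$ and $\partial_2:(a(x,\omega))_{(x,\omega)\in\Lambda}\mapsto(2\pi i\omega\,a(x,\omega))_{(x,\omega)\in\Lambda}$, and let $D$ be the unbounded selfadjoint operator on $\ell^2(\Lambda)\oplus\ell^2(\Lambda)$ given by $$D=\begin{pmatrix}0&\partial_1+i\partial_2\\-\partial_1+i\partial_2&0\end{pmatrix},$$ so that $|D|$ is multiplication by $2\pi(x^2+\omega^2)^{1/2}$ in each component. Let $n,k\in\mathbb N$ with $n\ge k+1$. Then both $(\ell^1_{v^n}(\Lambda,c),\ \ell^2(\Lambda)\oplus\ell^2(\Lambda),\ |D|)$ and $(\ell^1_{v^n}(\Lambda,c),\ \ell^2(\Lambda)\oplus\ell^2(\Lambda),\ D)$ are quantum $C^k$ spectral triples for the noncommutative $2$-torus $C^*(\Lambda,c)$.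
   Context: Lattice: a discrete cocompact subgroup. $\ell^1_{v^n}(\Lambda,c)$ is $\{a\in\ell^1(\Lambda):\sum_\lambda|a(\lambda)|v(\lambda)^n<\infty\}$ with twisted convolution $(a_1*_c a_2)(\lambda)=\sum_{\lambda'\in\Lambda}a_1(\lambda')a_2(\lambda-\lambda')c(\lambda',\lambda-\lambda')$ and involution $a^*(\lambda)=c(\lambda,\lambda)\overline{a(-\lambda)}$. $C^*(\Lambda,c)$ is the twisted group $C^*$-algebra, the $C^*$-completion of $\ell^1(\Lambda)$ with these operations (full and reduced completions agree). It acts on $\ell^2(\Lambda)$ by the continuous extension of left twisted convolution, and diagonally on $\ell^2(\Lambda)\oplus\ell^2(\Lambda)$. $D$ and $|D|$ are taken with their natural maximal domains as (matrices of) multiplication operators. Spectral triple for a $C^*$-algebra $A$: a triple $(\mathcal A,\mathcal H,D)$ with $\mathcal A\subset A$ a dense $*$-subalgebra, $\mathcal H$ a Hilbert space on which $A$ is represented, and $D$ a densely defined selfadjoint operator on $\mathcal H$, such that for every $a\in\mathcal A$: $a\,\mathrm{Dom}(D)\subset\mathrm{Dom}(D)$, $[D,a]$ extends to a bounded operator, and $a(1+D^2)^{-1/2}$ is compact. Quantum $C^k$: $\mathrm{ad}^j(|D|)(T)$ denotes the $j$ times iterated commutator $[|D|,[|D|,\dots,[|D|,T]\dots]]$, and $T$ lies in the domain of $\mathrm{ad}^k(|D|)$ if the iterated commutators up to order $k$ are defined and extend to bounded operators. The spectral triple $(\mathcal A,\mathcal H,D)$ is quantum $C^k$ if for all $a\in\mathcal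 A$ both $a$ and $[D,a]$ are in the domain of $\mathrm{ad}^k(|D|)$. *)

(* Defs.v *)
From HB Require Import structures.
From mathcomp Require Import all_boot all_order all_algebra.
From mathcomp Require Import complex ring.
From mathcomp Require Import all_classical all_reals all_analysis.

Set Implicit Arguments.
Unset Strict Implicit.
Unset Printing Implicit Defensive.

Import Order.TTheory GRing.Theory Num.Theory.
Import numFieldNormedType.Exports.

Local Open Scope classical_set_scope.
Local Open Scope ring_scope.
Local Open Scope complex_scope.

(* Only the data; the Hilbert space axioms are [is_hilbert]. *)
Record ipSpace (R : realType) := IpSpace {
  ipCarrier :> lmodType R[i];
  inner : ipCarrier -> ipCarrier -> R[i] }.
Arguments IpSpace {R}.

Section Operators.
Context {R : realType} (H : ipSpace R).

Definition hnorm (x : H) : R := Num.sqrt (complex.Re (inner x x)).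

(* The inner product is linear in its first argument. *)
Definition is_hilbert : Prop :=
  [/\ forall (a : R[i]) (x y z : H),
        inner (a *: x + y) z = a * inner x z + inner y z,
      forall x y : H, inner y x = (inner x y)^*%C,
      forall x : H, 0 <= inner x x,
      forall x : H, inner x x = 0 -> x = 0 &
      forall u : nat -> H,
        (forall e : R, 0 < e -> exists N, forall i j,
           (N <= i)%N -> (N <= j)%N -> hnorm (u i - u j) < e) ->
        exists l : H, hnorm (u i - l) @[i --> \oo] --> (0 : R)].

Definition bounded_op (f : H -> H) : Prop :=
  linear f /\ exists M : R, forall x, hnorm (f x) <= M * hnorm x.

Definition adjoint_of (f g : H -> H) : Prop :=
  forall x y, inner (f x) y = inner x (g y).

Definition opnorm_le (f : H -> H) (M : R) : Prop :=
  forall x, hnorm (f x) <= M * hnorm x.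

Definition compact_op (f : H -> H) : Prop :=
  forall u : nat -> H, (exists M : R, forall i, hnorm (u i) <= M) ->
  exists (s : nat -> nat) (l : H),
    (forall i j, (i < j)%N -> (s i < s j)%N) /\
    hnorm (f (u (s i)) - l) @[i --> \oo] --> (0 : R).

(* An unbounded operator is given by its graph, so that equality of operators
   includes equality of domains. *)
Definition uop := set (H * H).

Implicit Types S T : uop.

Definition dom T : set H := [set x | exists y, T (x, y)].

Definition is_operator T : Prop :=
  [/\ T (0, 0),
      forall (a : R[i]) x x' y y',
        T (x, y) -> T (x', y') -> T (a *: x + x', a *: y + y') &
      forall x y y', T (x, y) -> T (x, y') -> y = y'].

Definition densely_defined T : Prop :=
  forall (x : H) (e : R), 0 < e -> exists y, dom T y /\ hnorm (x - y) < e.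

Definition uop_of (f : H -> H) : uop := [set p | p.2 = f p.1].

Definition uop_add S T : uop :=
  [set p | exists y z, [/\ S (p.1, y), T (p.1, z) & p.2 = y + z]].

Definition uop_scale (a : R[i]) T : uop :=
  [set p | exists y, T (p.1, y) /\ p.2 = a *: y].

Definition uop_comp S T : uop :=
  [set p | exists y, T (p.1, y) /\ S (y, p.2)].

Definition uop_inv T : uop := [set p | T (p.2, p.1)].

Definition uop_adj T : uop :=
  [set p | forall x y, T (x, y) -> inner y p.1 = inner x p.2].

Definition selfadjoint T : Prop :=
  [/\ is_operator T, densely_defined T & uop_adj T = T].

Definition positive T : Prop := forall x y, T (x, y) -> 0 <= inner y x.

(* [S] is [|T|], the positive selfadjoint square root of [T^* T]. *)
Definition abs_value T S : Prop :=
  [/\ selfadjoint S, positive S & uop_comp S S = uop_comp (uop_adj T) T].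

(* [f] is [(1 + T^2)^{-1/2}], the positive square root of [(1 + T^2)^{-1}]. *)
Definition resolvent_sqrt T (f : H -> H) : Prop :=
  [/\ bounded_op f, positive (uop_of f) &
      uop_of (f \o f) = uop_inv (uop_add (uop_of id) (uop_comp T T))].

Definition preserves_dom T (f : H -> H) : Prop := forall x, dom T x -> dom T (f x).

(* [T f - f T] on [[set x in dom T | f x in dom T]]. *)
Definition commutator T (f : H -> H) : uop :=
  [set p | exists y z, [/\ T (p.1, y), T (f p.1, z) & p.2 = z - f y]].

(* The commutator is defined on the dense subspace [dom T], so its bounded
   extension [g] is unique. *)
Definition commutator_ext T (f g : H -> H) : Prop :=
  [/\ preserves_dom T f, bounded_op g & commutator T f `<=` uop_of g].

Fixpoint in_dom_ad (k : nat) T (f : H -> H) : Prop :=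
  if k is k'.+1 then
    bounded_op f /\ exists g, commutator_ext T f g /\ in_dom_ad k' T g
  else bounded_op f.

(* Concrete C*-algebras: norm-closed *-subalgebras of the bounded operators. *)
Definition star_subalgebra (A : set (H -> H)) : Prop :=
  [/\ A `<=` bounded_op,
      A (fun=> 0),
      forall (a : R[i]) f g, A f -> A g -> A (fun x => a *: f x + g x),
      forall f g, A f -> A g -> A (f \o g) &
      forall f, A f -> exists g, A g /\ adjoint_of f g].

Definition op_closure (B : set (H -> H)) : set (H -> H) :=
  [set f | bounded_op f /\ forall e : R, 0 < e ->
     exists g, B g /\ opnorm_le (fun x => f x - g x) e].

Definition cstar_algebra (A : set (H -> H)) : Prop :=
  star_subalgebra A /\ op_closure A `<=` A.

End Operators.

Arguments uop {R} H.
Arguments is_hilbert {R} H.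

Section SpectralTriples.
Context {R : realType} (H0 H : ipSpace R).

Definition star_representation (A : set (H0 -> H0))
    (rho : (H0 -> H0) -> H -> H) : Prop :=
  [/\ forall f, A f -> bounded_op (rho f),
      forall (a : R[i]) f g, A f -> A g ->
        rho (fun x => a *: f x + g x) = (fun x => a *: rho f x + rho g x),
      forall f g, A f -> A g -> rho (f \o g) = rho f \o rho g &
      forall f g, A f -> A g -> adjoint_of f g -> adjoint_of (rho f) (rho g)].

Definition spectral_triple (A : set (H0 -> H0)) (rho : (H0 -> H0) -> H -> H)
    (calA : set (H0 -> H0)) (D : uop H) : Prop :=
  [/\ is_hilbert H0, cstar_algebra A, is_hilbert H & star_representation A rho] /\
  [/\ star_subalgebra calA, calA `<=` A, A `<=` op_closure calA, selfadjoint D &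
      exists S, resolvent_sqrt D S /\
        forall a, calA a ->
          (exists B, commutator_ext D (rho a) B) /\ compact_op (rho a \o S)].

Definition quantum_C (k : nat) (rho : (H0 -> H0) -> H -> H)
    (calA : set (H0 -> H0)) (D : uop H) : Prop :=
  exists absD, abs_value D absD /\
    forall a, calA a ->
      in_dom_ad k absD (rho a) /\
      exists B, commutator_ext D (rho a) B /\ in_dom_ad k absD B.

Definition quantum_C_spectral_triple (k : nat) (A : set (H0 -> H0))
    (rho : (H0 -> H0) -> H -> H) (calA : set (H0 -> H0)) (D : uop H) : Prop :=
  spectral_triple A rho calA D /\ quantum_C k rho calA D.

(* [B], with the product [mul] and involution [star], is a *-algebra that
   [iota] embeds in the C*-algebra [A]. *)
Definition star_embedding (E : lmodType R[i]) (mul : E -> E -> E) (star : E -> E)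
    (B : set E) (A : set (H0 -> H0)) (iota : E -> H0 -> H0) : Prop :=
  [/\ B 0,
      forall (a : R[i]) x y, B x -> B y -> B (a *: x + y),
      forall x y, B x -> B y -> B (mul x y) &
      forall x, B x -> B (star x)] /\
  [/\ forall x, B x -> A (iota x),
      forall (a : R[i]) x y, B x -> B y ->
        iota (a *: x + y) = (fun f => a *: iota x f + iota y f),
      forall x y, B x -> B y -> iota (mul x y) = iota x \o iota y,
      forall x, B x -> adjoint_of (iota x) (iota (star x)) &
      forall x y, B x -> B y -> iota x = iota y -> x = y].

End SpectralTriples.

Section DirectSum.
Context {R : realType} (H K : ipSpace R).

Definition dsum : ipSpace R :=
  IpSpace (H * K)%type (fun x y => inner x.1 y.1 + inner x.2 y.2).

End DirectSum.

Section Blocks.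
Context {R : realType} (H : ipSpace R).

Definition diag_rep (f : H -> H) : dsum H H -> dsum H H :=
  fun x => (f x.1, f x.2).

(* The block operators [[S, 0], [0, T]] and [[0, S], [T, 0]]. *)
Definition uop_diag (S T : uop H) : uop (dsum H H) :=
  [set p | S (p.1.1, p.2.1) /\ T (p.1.2, p.2.2)].

Definition uop_offdiag (S T : uop H) : uop (dsum H H) :=
  [set p | S (p.1.2, p.2.1) /\ T (p.1.1, p.2.2)].

End Blocks.

Section Sequences.
Context {R : realType} (I : choiceType).
Implicit Types (a f : I -> R[i]).

(* Meaningful for absolutely summable families only. *)
Definition rsum (f : I -> R) : R :=
  fine (\esum_(i in [set: I]) (EFin \o f)^\+ i -
        \esum_(i in [set: I]) (EFin \o f)^\- i)%E.

Definition csum f : R[i] :=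
  rsum (fun i => complex.Re (f i)) +i* rsum (fun i => complex.Im (f i)).

Definition ell1 : set (I -> R[i]) :=
  [set a | (\esum_(i in [set: I]) (Normc.normc (a i))%:E < +oo)%E].

Definition square_summable : {pred I -> R[i]} :=
  [pred f | `[< (\esum_(i in [set: I]) (Normc.normc (f i) ^+ 2)%:E < +oo)%E >]].

Lemma normcD2 (z w : R[i]) :
  Normc.normc (z + w) ^+ 2 <= 2 * Normc.normc z ^+ 2 + 2 * Normc.normc w ^+ 2.
Proof.
case: z w => [a b] [c d] /=.
rewrite !sqr_sqrtr ?addr_ge0 ?sqr_ge0 // -subr_ge0.
rewrite [leRHS](_ : _ = (a - c) ^+ 2 + (b - d) ^+ 2) ?addr_ge0 ?sqr_ge0 //.
by ring.
Qed.

Lemma square_summable_submod : submod_closed square_summable.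
Proof.
split=> [|a f g].
  rewrite unfold_in; apply/asboolP; rewrite esum1 => [|i _]; first exact: ltry.
  by rewrite [X in X ^+ 2]Normc.normc0 expr0n.
rewrite !unfold_in => /asboolP sf /asboolP sg; apply/asboolP.
have ge0 (c : R) (h : I -> R[i]) i : 0 <= c ->
    (0 <= c%:E * (Normc.normc (h i) ^+ 2)%:E)%E.
  by move=> c0; rewrite lee_fin mulr_ge0 ?sqr_ge0.
have sumZ (c : R) (h : I -> R[i]) : 0 < c ->
    (\esum_(i in [set: I]) (Normc.normc (h i) ^+ 2)%:E < +oo)%E ->
    (\esum_(i in [set: I]) (c%:E * (Normc.normc (h i) ^+ 2)%:E) < +oo)%E.
  move=> c0 sh; set s := (X in (X < +oo)%E) in sh.
  have s0 : (0 <= s)%E by apply: esum_ge0 => i _; rewrite lee_fin sqr_ge0.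
  apply: (@le_lt_trans _ _ (c%:E * s)%E); last first.
    by rewrite lte_mul_pinfty // lee_fin ltW.
  apply: ge_ereal_sup => _ [F [finF FI] <-].
  rewrite -ge0_mule_fsumr; last by move=> i; rewrite lee_fin sqr_ge0.
  by apply: lee_wpmul2l; [rewrite lee_fin ltW|apply: ereal_sup_ubound; exists F].
pose c := 2 * Normc.normc a ^+ 2 + 1.
have c0 : 0 < c by rewrite ltr_wpDl // mulr_ge0 ?sqr_ge0.
apply: (@le_lt_trans _ _
  (\esum_(i in [set: I]) (c%:E * (Normc.normc (f i) ^+ 2)%:E
     + 2%:E * (Normc.normc (g i) ^+ 2)%:E))%E).
  apply: le_esum => i _; rewrite -!EFinM -EFinD lee_fin.
  apply: (le_trans (normcD2 _ _)); rewrite lerD2r Normc.normcM exprMn mulrA.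
  by rewrite ler_wpM2r ?sqr_ge0 // lerDl.
rewrite esumD; [|by move=> i _; exact/ge0/ltW|by move=> i _; exact: ge0].
by rewrite lte_add_pinfty //; apply: sumZ.
Qed.

HB.instance Definition _ :=
  GRing.isSubmodClosed.Build R[i] (I -> R[i]) square_summable
    square_summable_submod.

Definition ell2_seq := {f : I -> R[i] | f \in square_summable}.

HB.instance Definition _ := SubChoice.on ell2_seq.
HB.instance Definition _ := [SubChoice_isSubLmodule of ell2_seq by <:].

Definition ell2 : ipSpace R :=
  IpSpace ell2_seq (fun f g : ell2_seq => csum (fun i => val f i * (val g i)^*%C)).

Definition mulop (m : I -> R[i]) : uop ell2 :=
  [set p : ell2_seq * ell2_seq | forall i, val p.2 i = m i * val p.1 i].

End Sequences.

Arguments ell1 : clear implicits.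
Arguments ell2_seq : clear implicits.
Arguments ell2 : clear implicits.

Section NoncommutativeTorus.
Context {R : realType}.

Definition is_lattice (L : zmodClosed (R * R)%type) : Prop :=
  (forall x, x \in L -> isolated [set y | y \in L] x) /\
  compact [set: quotient_topology (Quotient.quot L)].

Definition lattice_point (L : zmodClosed (R * R)%type) := {x : R * R | x \in L}.

HB.instance Definition _ L := SubChoice.on (lattice_point L).
HB.instance Definition _ L := [SubChoice_isSubZmodule of lattice_point L by <:].

Context (L : zmodClosed (R * R)%type).
Local Notation Lambda := (lattice_point L).
Implicit Types (a b : Lambda -> R[i]) (l m : Lambda).

Definition weight l : R := Num.sqrt (1 + (val l).1 ^+ 2 + (val l).2 ^+ 2).

Definition ell1w (n : nat) : set (Lambda -> R[i]) :=
  [set a | ell1 R Lambda a /\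
     (\esum_(l in [set: Lambda]) (Normc.normc (a l) * weight l ^+ n)%:E < +oo)%E].

Definition expi (t : R) : R[i] := cos t +i* sin t.

Definition cocycle l m : R[i] := expi (- (2 * pi * (val m).2 * (val l).1)).

Definition tconv a b : Lambda -> R[i] :=
  fun l => csum (fun m => a m * b (l - m) * cocycle m (l - m)).

Definition tstar a : Lambda -> R[i] := fun l => cocycle l l * (a (- l))^*%C.

(* For [a] in [ell1] the twisted convolution is always square summable. *)
Definition lconv a : ell2 R Lambda -> ell2 R Lambda :=
  fun f : ell2_seq R Lambda => insubd (0 : ell2_seq R Lambda) (tconv a (val f)).

(* The reduced completion, which is also the full one, [Lambda] being abelian. *)
Definition twisted_cstar : set (ell2 R Lambda -> ell2 R Lambda) :=
  op_closure (lconv @` ell1 R Lambda).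

Definition partial1 : uop (ell2 R Lambda) :=
  mulop (fun l => 'i%C * (2 * pi * (val l).1)%:C).

Definition partial2 : uop (ell2 R Lambda) :=
  mulop (fun l => 'i%C * (2 * pi * (val l).2)%:C).

Definition dirac_op : uop (dsum (ell2 R Lambda) (ell2 R Lambda)) :=
  uop_offdiag (uop_add partial1 (uop_scale 'i%C partial2))
    (uop_add (uop_scale (-1) partial1) (uop_scale 'i%C partial2)).

Definition abs_symbol : uop (ell2 R Lambda) :=
  mulop (fun l => (2 * pi * Num.sqrt ((val l).1 ^+ 2 + (val l).2 ^+ 2))%:C).

Definition abs_dirac_op : uop (dsum (ell2 R Lambda) (ell2 R Lambda)) :=
  uop_diag abs_symbol abs_symbol.

End NoncommutativeTorus.

Arguments ell1w {R} L n.
Arguments twisted_cstar {R} L.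
Arguments dirac_op {R} L.
Arguments abs_dirac_op {R} L.

(* Main.v *)
(* Every operator involved is a kernel operator
   (K f)(l) = sum_m K(l, m) f(l - m) with |K(l, m)| <= alpha(m) and alpha
   summable; by Young's inequality it is bounded on l^2.  The commutator of such
   an operator with multiplication by d has the kernel (d(l) - d(l - m)) K(l, m).
   For the symbols of |D| and of the corners of D the triangle inequality gives
   |d(l) - d(l - m)| <= 2 pi |m|, so each commutator costs one power of the
   weight: [D, a] and the k commutators with |D| use k + 1 <= n powers.
   (1 + D^2)^(-1/2) is multiplication by a symbol vanishing at infinity, because
   a lattice has finitely many points in each ball, hence it is compact. *)
Require Import Defs.
From mathcomp Require Import all_boot all_order all_algebra.
From mathcomp Require Import complex ring lra.
From mathcomp Require Import all_classical all_reals all_analysis.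

Set Implicit Arguments.
Unset Strict Implicit.
Unset Printing Implicit Defensive.

Import Order.TTheory GRing.Theory Num.Theory.
Import numFieldNormedType.Exports.

Local Open Scope ring_scope.
Local Open Scope complex_scope.
Local Open Scope classical_set_scope.

(** Kernels replace convolutions because the coefficients [d l - d (l - m)] of a commutator with
    [|D|] depend on [l]: in general [[|D|, a]] is no longer a twisted convolution, and an argument
    inside the l^1 algebra would stop after one step. A bound [alpha m] uniform in [l] survives
    every commutator. The other obstacle is domains. Unbounded operators are graphs, so
    [D^2 = |D|^2] is also an equality of domains, and in general sums or products of multiplication
    operators agree with multiplication by the sum or product of the symbols only under a growth
    condition. Once [D] and [|D|] are known to have the same square, they share [(1 + D^2)^(-1/2)]
    and are treated by one argument. Compactness is extracted from an ultrafilter: along a bounded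
    sequence each coordinate varies little on some set of the ultrafilter, and finitely many such
    sets can be intersected. *)

Notation normc := Normc.normc.

(** * Unordered sums *)

Section RealSums.
Context {R : realType} {I : choiceType}.
Implicit Types f g : I -> R.

Definition rsummable f : Prop := summable [set: I] (EFin \o f).

Lemma rsummable_le f g : (forall i, `|f i| <= g i) -> rsummable g -> rsummable f.
Proof.
move=> fg; apply: le_lt_trans; apply: le_esum => i _ /=.
by rewrite lee_fin (le_trans (fg i))// ler_norm.
Qed.

Lemma rsummableD f g : rsummable f -> rsummable g -> rsummable (fun i => f i + g i).
Proof. exact: summableD. Qed.

Lemma rsummable_esum f : rsummable f -> (forall i, 0 <= f i) ->
  \esum_(i in [set: I]) (f i)%:E = (rsum f)%:E.
Proof.
move=> sf f0; rewrite /rsum.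
have -> : (\esum_(i in [set: I]) (EFin \o f)^\- i = 0)%E.
  by apply: esum1 => i _; rewrite funenegE /= max_r// lee_fin oppr_le0.
have -> : (\esum_(i in [set: I]) (EFin \o f)^\+ i = \esum_(i in [set: I]) (f i)%:E)%E.
  by apply: eq_esum => i _; rewrite funeposE /= max_l// lee_fin.
rewrite sube0 fineK// ge0_fin_numE.
  by apply: le_lt_trans sf; apply: le_esum => i _ /=; rewrite lee_fin ler_norm.
by apply: esum_ge0 => i _; rewrite lee_fin.
Qed.

Lemma rsummableP f (M : \bar R) : (forall i, 0 <= f i) -> (M < +oo)%E ->
  (\esum_(i in [set: I]) (f i)%:E <= M)%E -> rsummable f.
Proof.
move=> f0 M1 M2; apply: le_lt_trans M1; apply: le_trans M2.
by apply: le_esum => i _ /=; rewrite ger0_norm.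
Qed.

(** [rsum] is built from the canonical positive and negative parts; any other decomposition into
    nonnegative summable families gives the same value. Additivity for signed families is deduced
    from this. *)
Lemma rsumB f g : rsummable f -> rsummable g ->
  (forall i, 0 <= f i) -> (forall i, 0 <= g i) ->
  rsum (fun i => f i - g i) = rsum f - rsum g.
Proof.
move=> sf sg f0 g0; rewrite [LHS]/rsum.
rewrite (@esumB R I setT (EFin \o f) (EFin \o g) sf sg); last 2 first.
- by move=> i _; rewrite lee_fin.
- by move=> i _; rewrite lee_fin.
by rewrite (rsummable_esum sf f0) (rsummable_esum sg g0).
Qed.

Definition rpos f i : R := Num.max (f i) 0.
Definition rneg f i : R := Num.max (- f i) 0.

Lemma rpos_ge0 f i : 0 <= rpos f i. Proof. by rewrite le_max lexx orbT. Qed.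
Lemma rneg_ge0 f i : 0 <= rneg f i. Proof. by rewrite le_max lexx orbT. Qed.
Lemma rposB f i : rpos f i - rneg f i = f i.
Proof.
rewrite /rpos /rneg; case: (leP 0 (f i)) => h.
  by rewrite max_r ?subr0// oppr_le0.
by rewrite max_l ?oppr_ge0 ?ltW// sub0r opprK.
Qed.
Lemma rpos_le f i : rpos f i <= `|f i|.
Proof. by rewrite ge_max ler_norm normr_ge0. Qed.
Lemma rneg_le f i : rneg f i <= `|f i|.
Proof. by rewrite ge_max -normrN ler_norm normr_ge0. Qed.

Lemma rsummable_norm f : rsummable f -> rsummable (fun i => `|f i|).
Proof.
apply: le_lt_trans; apply: le_esum => i _ /=; by rewrite normr_id.
Qed.

Lemma rsummable_pos f : rsummable f -> rsummable (rpos f).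
Proof.
move/rsummable_norm; apply: rsummable_le => i.
by rewrite ger0_norm ?rpos_ge0// rpos_le.
Qed.

Lemma rsummable_neg f : rsummable f -> rsummable (rneg f).
Proof.
move/rsummable_norm; apply: rsummable_le => i.
by rewrite ger0_norm ?rneg_ge0// rneg_le.
Qed.

Lemma rsum_posneg f : rsummable f -> rsum f = rsum (rpos f) - rsum (rneg f).
Proof.
move=> sf; rewrite -rsumB; [|exact: rsummable_pos|exact: rsummable_neg
  |exact: rpos_ge0|exact: rneg_ge0].
by congr rsum; apply/funext => i; rewrite rposB.
Qed.

Lemma rsumD_ge0 f g : rsummable f -> rsummable g ->
  (forall i, 0 <= f i) -> (forall i, 0 <= g i) ->
  rsum (fun i => f i + g i) = rsum f + rsum g.
Proof.
move=> sf sg f0 g0; apply: (@EFin_inj R); rewrite EFinD -!rsummable_esum//; last 2 first.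
- exact: rsummableD.
- by move=> i; rewrite addr_ge0.
by rewrite -esumD//; move=> i _; rewrite lee_fin.
Qed.

Lemma rsumD f g : rsummable f -> rsummable g ->
  rsum (fun i => f i + g i) = rsum f + rsum g.
Proof.
move=> sf sg.
rewrite (rsum_posneg sf) (rsum_posneg sg).
have -> : (fun i => f i + g i) =
    (fun i => (rpos f i + rpos g i) - (rneg f i + rneg g i)).
  by apply/funext => i; rewrite -{1}(rposB f) -{1}(rposB g); ring.
have [sfp sfn] := (rsummable_pos sf, rsummable_neg sf).
have [sgp sgn] := (rsummable_pos sg, rsummable_neg sg).
have := rpos_ge0; have := rneg_ge0 => n0 p0.
rewrite rsumB ?rsumD_ge0//; first by ring.
- exact: rsummableD.
- exact: rsummableD.
- by move=> i; rewrite addr_ge0.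
- by move=> i; rewrite addr_ge0.
Qed.

Lemma rsummableN f : rsummable f -> rsummable (fun i => - f i).
Proof. by move/rsummable_norm; apply: rsummable_le => i; rewrite normrN. Qed.

Lemma rsumN f : rsummable f -> rsum (fun i => - f i) = - rsum f.
Proof.
move=> sf; rewrite (rsum_posneg sf) opprB -rsumB; [|exact: rsummable_neg|
  exact: rsummable_pos|exact: rneg_ge0|exact: rpos_ge0].
by congr rsum; apply/funext => i; rewrite -(rposB f) opprB.
Qed.

Lemma rsum_ge0 f : (forall i, 0 <= f i) -> 0 <= rsum f.
Proof.
move=> f0; rewrite /rsum fine_ge0//.
have -> : (\esum_(i in [set: I]) (EFin \o f)^\- i = 0)%E.
  by apply: esum1 => i _; rewrite funenegE /= max_r// lee_fin oppr_le0.
by rewrite sube0 esum_ge0// => i _; rewrite funeposE /= le_max lexx orbT.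
Qed.

Lemma rsum_le f g : rsummable f -> rsummable g -> (forall i, f i <= g i) ->
  rsum f <= rsum g.
Proof.
move=> sf sg fg; rewrite -subr_ge0 -rsumN// -rsumD//; last exact: rsummableN.
by apply: rsum_ge0 => i; rewrite subr_ge0.
Qed.

Lemma rsum_eq0 : rsum (fun _ : I => 0 : R) = 0.
Proof.
have s0 : rsummable (fun _ : I => 0).
  by rewrite /rsummable /summable esum1 ?ltry// => i _ /=; rewrite normr0.
by apply: (@EFin_inj R); rewrite -rsummable_esum// esum1.
Qed.

Lemma rsummableZ (c : R) f : rsummable f -> rsummable (fun i => c * f i).
Proof.
move=> sf; apply: (@le_lt_trans _ _ (`|c|%:E * \esum_(i in [set: I]) `|f i|%:E)%E); last first.
  by rewrite lte_mul_pinfty.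
apply: ge_ereal_sup => _ [F [finF FI] <-].
under eq_fsbigr do rewrite /= normrM EFinM.
rewrite -ge0_mule_fsumr; last by move=> i; rewrite lee_fin.
by apply: lee_wpmul2l; [rewrite lee_fin|apply: ereal_sup_ubound; exists F].
Qed.

Lemma rsumZ_ge0 (c : R) f : 0 <= c -> rsummable f -> (forall i, 0 <= f i) ->
  rsum (fun i => c * f i) <= c * rsum f.
Proof.
move=> c0 sf f0; rewrite -lee_fin -rsummable_esum; last 2 first.
- exact: rsummableZ.
- by move=> i; rewrite mulr_ge0.
rewrite EFinM -rsummable_esum//.
apply: ge_ereal_sup => _ [F [finF FI] <-].
under eq_fsbigr do rewrite EFinM.
rewrite -ge0_mule_fsumr; last by move=> i; rewrite lee_fin.
by apply: lee_wpmul2l; [rewrite lee_fin|apply: ereal_sup_ubound; exists F].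
Qed.

(** The reverse inequality is [rsumZ_ge0] for the factor [c^-1] and the family [c * f]. *)
Lemma rsumZ_pos (c : R) f : 0 <= c -> rsummable f -> (forall i, 0 <= f i) ->
  rsum (fun i => c * f i) = c * rsum f.
Proof.
rewrite le_eqVlt => /predU1P[<-|c0] sf f0.
  by rewrite mul0r -[RHS]rsum_eq0; congr rsum; apply/funext => i; rewrite mul0r.
apply/eqP; rewrite eq_le (rsumZ_ge0 (ltW c0))//= -ler_pdivlMl//.
have -> : rsum f = rsum (fun i => c^-1 * (c * f i)).
  by congr rsum; apply/funext => i; rewrite mulKf// gt_eqF.
apply: rsumZ_ge0; rewrite ?invr_ge0 ?ltW//; first exact: rsummableZ.
by move=> i; rewrite mulr_ge0// ltW.
Qed.

Lemma rsumZ (c : R) f : rsummable f -> rsum (fun i => c * f i) = c * rsum f.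
Proof.
wlog c0 : c f / 0 <= c => [hw sf|sf].
  case: (leP 0 c) => [c0|/ltW c0]; first exact: hw.
  rewrite -[RHS]opprK -mulNr -hw ?oppr_ge0// -rsumN; last exact: rsummableZ.
  by congr rsum; apply/funext => i; rewrite mulNr opprK.
rewrite (rsum_posneg sf) mulrBr -!rsumZ_pos//; [|exact: rsummable_neg|exact: rneg_ge0
  |exact: rsummable_pos|exact: rpos_ge0].
rewrite -rsumB; last 4 first.
- exact/rsummableZ/rsummable_pos.
- exact/rsummableZ/rsummable_neg.
- by move=> i; rewrite mulr_ge0// rpos_ge0.
- by move=> i; rewrite mulr_ge0// rneg_ge0.
by congr rsum; apply/funext => i; rewrite -mulrBr rposB.
Qed.

Lemma rsum_fin_le f (F : set I) : rsummable f -> (forall i, 0 <= f i) ->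
  finite_set F -> \sum_(i \in F) f i <= rsum f.
Proof.
move=> sf f0 finF; rewrite -lee_fin -rsummable_esum//.
rewrite -fsumEFin//; by apply: ereal_sup_ubound; exists F.
Qed.

Lemma rsum_le_fin f (M : R) : (forall i, 0 <= f i) ->
  (forall F : set I, finite_set F -> \sum_(i \in F) f i <= M) ->
  rsummable f /\ rsum f <= M.
Proof.
move=> f0 fM.
have h : (\esum_(i in [set: I]) (f i)%:E <= M%:E)%E.
  by apply: ge_ereal_sup => _ [F [finF _] <-]; rewrite fsumEFin// lee_fin fM.
have sf : rsummable f by apply: rsummableP h => //; rewrite ltry.
by split=> //; rewrite -lee_fin -rsummable_esum.
Qed.

Lemma rsum_ge1 f i : rsummable f -> (forall i, 0 <= f i) -> f i <= rsum f.
Proof.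
move=> sf f0; have := rsum_fin_le sf f0 (finite_set1 i).
by rewrite fsbig_set1.
Qed.

(** The sum is the supremum of its finite partial sums, so some finite set carries all but [e] of
    it. This is the source of every truncation to finite support below. *)
Lemma rsum_tail f (e : R) : rsummable f -> (forall i, 0 <= f i) -> 0 < e ->
  exists F : set I, finite_set F /\
    rsum (fun i => if i \in F then 0 else f i) < e.
Proof.
move=> sf f0 e0.
have := rsummable_esum sf f0.
have : ((rsum f - e)%:E < \esum_(i in [set: I]) (f i)%:E)%E.
  by rewrite rsummable_esum// lte_fin ltrBlDr ltrDl.
move=> /ereal_sup_gt[_ [F [finF _] <-]]; rewrite fsumEFin// lte_fin => h _.
exists F; split=> //.
pose g1 i := if i \in F then f i else 0.
pose g2 i := if i \in F then 0 else f i.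
have s1 : rsummable g1.
  by apply: rsummable_le sf => i; rewrite /g1; case: ifP; rewrite ?normr0 ?ger0_norm.
have s2 : rsummable g2.
  by apply: rsummable_le sf => i; rewrite /g2; case: ifP; rewrite ?normr0 ?ger0_norm.
have e1 : rsum f = rsum g1 + rsum g2.
  rewrite -rsumD//; congr rsum; apply/funext => i.
  by rewrite /g1 /g2; case: ifP; rewrite ?add0r ?addr0.
have : \sum_(i \in F) f i <= rsum g1.
  have -> : \sum_(i \in F) f i = \sum_(i \in F) g1 i.
    by apply: eq_fsbigr => i iF; rewrite /g1 iF.
  by apply: rsum_fin_le => // i; rewrite /g1; case: ifP.
rewrite -/g2; lra.
Qed.

Lemma rsum_single f i : (forall j, j != i -> f j = 0) -> rsummable f /\ rsum f = f i.
Proof.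
have key g : (forall j, 0 <= g j) -> (forall j, j != i -> g j = 0) ->
    (\esum_(j in [set: I]) (g j)%:E = (g i)%:E)%E.
  move=> g0 h; rewrite -[RHS](@esum_set1 R I i (EFin \o g)) ?lee_fin//.
  rewrite [RHS]esum_mkcond; apply: eq_esum => j _ /=; case: ifPn => // /negP ji.
  by rewrite h//; apply/eqP => e; apply: ji; rewrite inE.
move=> h.
have sf : rsummable f.
  rewrite /rsummable /summable /= (key (fun j => `|f j|)) ?ltry// => j /h ->.
  by rewrite normr0.
split=> //; rewrite rsum_posneg// -[RHS]rposB.
congr (_ - _); apply: (@EFin_inj R).
  rewrite -rsummable_esum; [|exact: rsummable_pos|exact: rpos_ge0].
  by apply: key => [j|j /h]; [exact: rpos_ge0|rewrite /rpos => ->; rewrite maxxx].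
rewrite -rsummable_esum; [|exact: rsummable_neg|exact: rneg_ge0].
by apply: key => [j|j /h]; [exact: rneg_ge0|rewrite /rneg => ->; rewrite oppr0 maxxx].
Qed.

End RealSums.

(** * Tonelli and Fubini for unordered real sums *)

Section RealFubini.
Context {R : realType} {I J : choiceType}.

Lemma esum_swap (a : I -> J -> \bar R) : (forall i j, 0 <= a i j)%E ->
  (\esum_(i in [set: I]) \esum_(j in [set: J]) a i j =
   \esum_(j in [set: J]) \esum_(i in [set: I]) a i j)%E.
Proof.
move=> a0; rewrite esum_esum// esum_esum//.
rewrite (@reindex_esum R (I * J)%type (J * I)%type ([set: I] `*`` fun=> [set: J])
  ([set: J] `*`` fun=> [set: I]) (fun k => (k.2, k.1)) (fun k => a k.2 k.1)) //.
split=> //.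
- by move=> [x y] [x' y'] _ _ [-> ->].
- by move=> [x y] _; exists (y, x).
Qed.

Lemma reindex_rsum (e : I -> J) (f : J -> R) : bijective e ->
  rsum (f \o e) = rsum f.
Proof.
move=> be.
have sb : set_bij [set: I] [set: J] e by rewrite setTT_bijective.
rewrite /rsum (reindex_esum _ _ e _ sb) (reindex_esum _ _ e (funeneg (EFin \o f)) sb).
by congr (fine (_ - _)); apply: eq_esum => i _; rewrite ?funeposE ?funenegE.
Qed.

Lemma reindex_rsummable (e : I -> J) (f : J -> R) : bijective e ->
  rsummable f -> rsummable (f \o e).
Proof.
move=> be; have sb : set_bij [set: I] [set: J] e by rewrite setTT_bijective.
by rewrite /rsummable /summable (reindex_esum _ _ _ _ sb).
Qed.

(** Extended-valued sums make the condition meaningful before the inner sums are known to be finite;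
    by Tonelli the order of the indices is immaterial. *)
Definition rsummable2 (f : I -> J -> R) :=
  (\esum_(i in [set: I]) \esum_(j in [set: J]) `|f i j|%:E < +oo)%E.

Lemma esum_lty (g : I -> \bar R) i : (forall i, 0 <= g i)%E ->
  (\esum_(i in [set: I]) g i < +oo)%E -> (g i < +oo)%E.
Proof.
move=> g0; apply: le_lt_trans; apply: esum_ge; exists [set i].
  by split=> //; exact: finite_set1.
by rewrite fsbig_set1.
Qed.

Lemma rsummable2_row f i : rsummable2 f -> rsummable (f i).
Proof.
by move/esum_lty => /(_ i); apply => k; apply: esum_ge0 => j _; rewrite lee_fin.
Qed.

Lemma rsummable2_out f : (forall i j, 0 <= f i j) -> rsummable2 f ->
  rsummable (fun i => rsum (f i)) /\
  (\esum_(i in [set: I]) \esum_(j in [set: J]) (f i j)%:E =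
   (rsum (fun i => rsum (f i)))%:E)%E.
Proof.
move=> f0 sf.
have e i : (\esum_(j in [set: J]) (f i j)%:E = (rsum (f i))%:E)%E.
  by rewrite rsummable_esum//; exact: rsummable2_row.
have s : rsummable (fun i => rsum (f i)).
  apply: (le_lt_trans _ sf); apply: le_esum => i _ /=.
  rewrite ger0_norm; last exact: rsum_ge0.
  rewrite -e; apply: le_esum => j _; by rewrite ger0_norm.
split=> //; rewrite -rsummable_esum//; last by move=> i; exact: rsum_ge0.
exact: eq_esum.
Qed.

Lemma rsummable2_le (f g : I -> J -> R) : (forall i j, `|f i j| <= g i j) ->
  rsummable2 g -> rsummable2 f.
Proof.
move=> fg; apply: le_lt_trans; apply: le_esum => i _; apply: le_esum => j _.
by rewrite lee_fin (le_trans (fg i j))// ler_norm.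
Qed.

Lemma rsummable2I f : (forall i j, 0 <= f i j) -> (forall i, rsummable (f i)) ->
  rsummable (fun i => rsum (f i)) -> rsummable2 f.
Proof.
move=> f0 s1 s2; apply: (le_lt_trans _ s2); apply: le_esum => i _ /=.
rewrite ger0_norm; last exact: rsum_ge0.
rewrite -rsummable_esum//; apply: le_esum => j _; by rewrite ger0_norm.
Qed.

End RealFubini.

Section RealFubini2.
Context {R : realType} {I J : choiceType}.

Lemma rsummable2_swap (f : I -> J -> R) :
  rsummable2 f -> rsummable2 (fun j i => f i j).
Proof. by rewrite /rsummable2 esum_swap// => i j; rewrite lee_fin. Qed.

Lemma rsum_swap_ge0 (f : I -> J -> R) : (forall i j, 0 <= f i j) -> rsummable2 f ->
  rsum (fun i => rsum (f i)) = rsum (fun j => rsum (fun i => f i j)).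
Proof.
move=> f0 sf; apply: (@EFin_inj R).
have [_ <-] := rsummable2_out f0 sf.
have [_ <-] := rsummable2_out (fun j i => f0 i j) (rsummable2_swap sf).
by rewrite esum_swap// => i j; rewrite lee_fin.
Qed.


(** Tonelli for the positive and the negative parts separately. *)
Lemma rsum_swap (f : I -> J -> R) : rsummable2 f ->
  rsum (fun i => rsum (f i)) = rsum (fun j => rsum (fun i => f i j)).
Proof.
move=> sf; pose p i := rpos (f i); pose q i := rneg (f i).
have p0 i j : 0 <= p i j by exact: rpos_ge0.
have q0 i j : 0 <= q i j by exact: rneg_ge0.
have sn : rsummable2 (fun i j => `|f i j|).
  apply: le_lt_trans sf; apply: le_esum => i _; apply: le_esum => j _.
  by rewrite normr_id.
have sp : rsummable2 p.
  by apply: rsummable2_le sn => i j; rewrite ger0_norm// rpos_le.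
have sq : rsummable2 q.
  by apply: rsummable2_le sn => i j; rewrite ger0_norm// rneg_le.
have [sp1 _] := rsummable2_out p0 sp.
have [sq1 _] := rsummable2_out q0 sq.
have [sp2 _] := rsummable2_out (fun j i => p0 i j) (rsummable2_swap sp).
have [sq2 _] := rsummable2_out (fun j i => q0 i j) (rsummable2_swap sq).
transitivity (rsum (fun i => rsum (p i) - rsum (q i))).
  by congr rsum; apply/funext => i; rewrite rsum_posneg//; exact: rsummable2_row.
rewrite rsumB//; [|by move=> i; exact: rsum_ge0|by move=> i; exact: rsum_ge0].
rewrite !rsum_swap_ge0// -rsumB//; [|by move=> j; exact: rsum_ge0|by move=> j; exact: rsum_ge0].
congr rsum; apply/funext => j; rewrite -rsumB//; last 2 first.
- exact: (rsummable2_row _ (rsummable2_swap sp)).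
- exact: (rsummable2_row _ (rsummable2_swap sq)).
by congr rsum; apply/funext => i; rewrite rposB.
Qed.

End RealFubini2.

(** * Complex moduli and complex sums *)

Section ComplexAux.
Context {R : realType}.
Implicit Types z w : R[i].

Lemma normc_ge0 z : 0 <= normc z.
Proof. by case: z => a b; rewrite sqrtr_ge0. Qed.

Lemma normc_sq z : normc z ^+ 2 = complex.Re z ^+ 2 + complex.Im z ^+ 2.
Proof. by case: z => a b /=; rewrite sqr_sqrtr// addr_ge0// sqr_ge0. Qed.

Lemma normc_Re z : `|complex.Re z| <= normc z.
Proof.
case: z => a b /=; rewrite -sqrtr_sqr ler_sqrt ?lerDl ?sqr_ge0//.
by rewrite addr_ge0// sqr_ge0.
Qed.

Lemma normc_Im z : `|complex.Im z| <= normc z.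
Proof.
case: z => a b /=; rewrite -sqrtr_sqr ler_sqrt ?lerDr ?sqr_ge0//.
by rewrite addr_ge0// sqr_ge0.
Qed.

Lemma normc_le_ReIm z : normc z <= `|complex.Re z| + `|complex.Im z|.
Proof.
rewrite -(@ler_pXn2r R 2) ?nnegrE ?normc_ge0 ?addr_ge0//.
rewrite normc_sq sqrrD !real_normK ?num_real//.
by rewrite addrAC lerDl mulrn_wge0 // mulr_ge0.
Qed.

Lemma normc_conj z : normc z^*%C = normc z.
Proof. by case: z => a b /=; rewrite sqrrN. Qed.

Lemma normc_real (x : R) : normc x%:C = `|x|.
Proof. by rewrite /= expr0n addr0 sqrtr_sqr. Qed.

Lemma mulc_conj z : z * z^*%C = (normc z ^+ 2)%:C.
Proof. by rewrite normc_sq; case: z => a b; simpc; congr (_ +i* _) => /=; ring. Qed.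

Lemma ReM z w : complex.Re (z * w) =
  complex.Re z * complex.Re w - complex.Im z * complex.Im w.
Proof. by case: z; case: w. Qed.

Lemma ImM z w : complex.Im (z * w) =
  complex.Re z * complex.Im w + complex.Im z * complex.Re w.
Proof. by case: z; case: w. Qed.

Lemma ReD z w : complex.Re (z + w) = complex.Re z + complex.Re w.
Proof. by case: z; case: w. Qed.

Lemma ImD z w : complex.Im (z + w) = complex.Im z + complex.Im w.
Proof. by case: z; case: w. Qed.

Lemma ReJ z : complex.Re z^*%C = complex.Re z.
Proof. by case: z. Qed.

Lemma ImJ z : complex.Im z^*%C = - complex.Im z.
Proof. by case: z. Qed.

Lemma conjcM z w : (z * w)^*%C = z^*%C * w^*%C.
Proof. exact: rmorphM. Qed.

Lemma complex_ext z w : complex.Re z = complex.Re w ->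
  complex.Im z = complex.Im w -> z = w.
Proof. by case: z => a b; case: w => c d /= -> ->. Qed.

Lemma mul_le_sq (a b : R) : a * b <= (a ^+ 2 + b ^+ 2) / 2.
Proof. have := sqr_ge0 (a - b); rewrite sqrrB; lra. Qed.

(** Turning a sum onto the nonnegative real axis by such a [u] reduces the triangle inequality for
    complex sums to monotonicity of real ones. *)
Lemma rotate_normc z : exists u : R[i], normc u <= 1 /\ normc z = complex.Re (u * z).
Proof.
have [->|z0] := eqVneq z 0.
  by exists 0; rewrite mul0r Normc.normc0.
have n0 : normc z != 0 by apply: contra z0 => /eqP /Normc.eq0_normc ->.
exists ((normc z)^-1%:C * z^*%C); split.
  rewrite Normc.normcM normc_conj normc_real normfV ger0_norm ?normc_ge0//.
  by rewrite mulVf.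
rewrite -mulrA [_^*%C * _]mulrC mulc_conj -rmorphM /=.
by rewrite expr2 mulKf.
Qed.

End ComplexAux.

Section ComplexSums.
Context {R : realType} {I : choiceType}.
Implicit Types f g : I -> R[i].

Definition csummable f : Prop := rsummable (fun i => normc (f i)).

Lemma csummable_le f (g : I -> R) : (forall i, normc (f i) <= g i) ->
  rsummable g -> csummable f.
Proof. by move=> fg; apply: rsummable_le => i; rewrite ger0_norm ?normc_ge0. Qed.

Lemma ell1P f : ell1 R I f <-> csummable f.
Proof.
rewrite /ell1 /csummable /rsummable /summable /=.
by under [X in _ <-> (X < _)%E]eq_esum do rewrite /= ger0_norm ?normc_ge0//.
Qed.

Lemma csummable_Re f : csummable f -> rsummable (fun i => complex.Re (f i)).
Proof. by apply: rsummable_le => i; exact: normc_Re. Qed.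

Lemma csummable_Im f : csummable f -> rsummable (fun i => complex.Im (f i)).
Proof. by apply: rsummable_le => i; exact: normc_Im. Qed.

Lemma csummableD f g : csummable f -> csummable g -> csummable (fun i => f i + g i).
Proof.
by move=> sf sg; apply: csummable_le (rsummableD sf sg) => i; exact: le_normcD.
Qed.

Lemma csummableZ c f : csummable f -> csummable (fun i => c * f i).
Proof.
move=> sf; apply: csummable_le (rsummableZ (normc c) sf) => i.
by rewrite Normc.normcM.
Qed.

Lemma csummableJ f : csummable f -> csummable (fun i => (f i)^*%C).
Proof. by apply: csummable_le => i; rewrite normc_conj. Qed.

Lemma csumD f g : csummable f -> csummable g ->
  csum (fun i => f i + g i) = csum f + csum g.
Proof.
move=> sf sg; apply: complex_ext => /=.
  under eq_fun do rewrite ReD.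
  by rewrite rsumD//; exact: csummable_Re.
under eq_fun do rewrite ImD.
by rewrite rsumD//; exact: csummable_Im.
Qed.

Lemma csumZ c f : csummable f -> csum (fun i => c * f i) = c * csum f.
Proof.
move=> sf; have [sr si] := (csummable_Re sf, csummable_Im sf).
apply: complex_ext; rewrite ?ReM ?ImM /=.
  under eq_fun do rewrite ReM -mulNr.
  by rewrite rsumD ?rsumZ ?mulNr//; exact: rsummableZ.
under eq_fun do rewrite ImM.
by rewrite rsumD ?rsumZ//; exact: rsummableZ.
Qed.

Lemma csumJ f : csummable f -> csum (fun i => (f i)^*%C) = (csum f)^*%C.
Proof.
move=> sf; apply: complex_ext; rewrite ?ReJ ?ImJ /=.
  by congr rsum; apply/funext => i; rewrite ReJ.
rewrite -rsumN; last exact: csummable_Im.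
by congr rsum; apply/funext => i; rewrite ImJ.
Qed.

Lemma csum_real (f : I -> R) : csum (fun i => (f i)%:C) = (rsum f)%:C.
Proof. by apply: complex_ext => //=; rewrite rsum_eq0. Qed.

Lemma normc_csum f : csummable f -> normc (csum f) <= rsum (fun i => normc (f i)).
Proof.
move=> sf; have [u [u1 ->]] := rotate_normc (csum f).
rewrite -csumZ//=; have suf := csummableZ u sf.
apply: rsum_le => //; first exact: csummable_Re.
move=> i; rewrite (le_trans (ler_norm _))// (le_trans (normc_Re _))//.
by rewrite Normc.normcM ler_piMl// normc_ge0.
Qed.

Lemma csum_single f i : (forall j, j != i -> f j = 0) -> csum f = f i.
Proof.
move=> h; apply: complex_ext => /=.
  by have [_ ->] := @rsum_single R I (fun j => complex.Re (f j)) i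
    (fun j ji => congr1 (@complex.Re R) (h j ji)).
by have [_ ->] := @rsum_single R I (fun j => complex.Im (f j)) i
    (fun j ji => congr1 (@complex.Im R) (h j ji)).
Qed.

(* [0 <= sum alpha (g - t)^2] at the minimising [t]. *)
Lemma weighted_cauchy_schwarz (alpha g : I -> R) :
  (forall i, 0 <= alpha i) -> (forall i, 0 <= g i) ->
  rsummable alpha -> rsummable (fun i => alpha i * g i ^+ 2) ->
  rsummable (fun i => alpha i * g i) /\
  rsum (fun i => alpha i * g i) ^+ 2 <=
    rsum alpha * rsum (fun i => alpha i * g i ^+ 2).
Proof.
move=> a0 g0 sa sag2.
(* Since [g <= 1 + g^2], the terms are dominated by [alpha + alpha * g^2]. *)
have sag : rsummable (fun i => alpha i * g i).
  apply: rsummable_le (rsummableD sa sag2) => i.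
  rewrite ger0_norm ?mulr_ge0// -{2}[alpha i]mulr1 -mulrDr ler_wpM2l//.
  have := sqr_ge0 (g i - 1); have := g0 i; rewrite sqrrB1 mulr2n; nra.
split=> //.
set A := rsum alpha; set P := rsum (fun i => _ * g i); set Q := rsum _.
have A0 : 0 <= A by exact: rsum_ge0.
have main t : 0 <= Q - 2 * t * P + t ^+ 2 * A.
  have -> : Q - 2 * t * P + t ^+ 2 * A =
      rsum (fun i => alpha i * (g i - t) ^+ 2).
    have s1 := rsummableZ (- (2 * t)) sag; have s2 := rsummableZ (t ^+ 2) sa.
    rewrite /Q /P /A -mulNr -(rsumZ _ sag) -(rsumZ _ sa) -(rsumD sag2 s1).
    rewrite -(rsumD (rsummableD sag2 s1) s2).
    by congr rsum; apply/funext => i; ring.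
  by apply: rsum_ge0 => i; rewrite mulr_ge0// sqr_ge0.
(* For [A = 0] there is no minimiser, but then [Q - 2 t P] is nonnegative for every [t], whereas
   [t = (Q + 1) / (2 P)] would give [-1]. *)
have [A00|An0] := eqVneq A 0.
  rewrite A00 mul0r.
  have P0 : P = 0.
    have := main (Q + 1); have := main (- (Q + 1)); rewrite A00 mulr0 !addr0.
    have [P0|P0|//] := ltrgt0P P; last first.
    - have : 0 <= Q by apply: rsum_ge0 => i; rewrite mulr_ge0// sqr_ge0.
      have := main ((Q + 1) / (2 * P)); rewrite A00 mulr0 addr0.
      have -> : 2 * ((Q + 1) / (2 * P)) * P = Q + 1 by field; rewrite lt_eqF.
      by lra.
    - have := main ((Q + 1) / (2 * P)); rewrite A00 mulr0 addr0.
      have -> : 2 * ((Q + 1) / (2 * P)) * P = Q + 1 by field; rewrite gt_eqF.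
      by lra.
  by rewrite P0 expr0n.
have Ap : 0 < A by rewrite lt_def An0.
have := main (P / A).
have -> : Q - 2 * (P / A) * P + (P / A) ^+ 2 * A = (A * Q - P ^+ 2) / A by field.
by rewrite pmulr_lge0 ?invr_gt0// subr_ge0.
Qed.

End ComplexSums.

Section ComplexFubini.
Context {R : realType} {I J : choiceType}.

Definition csummable2 (f : I -> J -> R[i]) := rsummable2 (fun i j => normc (f i j)).

Lemma csum_swap (f : I -> J -> R[i]) : csummable2 f ->
  csum (fun i => csum (f i)) = csum (fun j => csum (fun i => f i j)).
Proof.
move=> sf; apply: complex_ext => /=; rewrite rsum_swap//.
  by apply: rsummable2_le sf => i j; exact: normc_Re.
by apply: rsummable2_le sf => i j; exact: normc_Im.
Qed.

Lemma reindex_csum (e : I -> J) (f : J -> R[i]) : bijective e ->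
  csum (fun i => f (e i)) = csum f.
Proof.
move=> be; rewrite /csum.
by rewrite -(reindex_rsum _ be) -(reindex_rsum (fun i => complex.Im (f i)) be).
Qed.

End ComplexFubini.

(** * Hilbert spaces *)

Section HilbertTheory.
Context {R : realType} (H : ipSpace R) (hH : is_hilbert H).
Implicit Types (x y z : H) (f g : H -> H).

Lemma seq_cvg0P (u : nat -> R) : (forall i, 0 <= u i) ->
  (u i @[i --> \oo] --> (0 : R)) <->
  (forall e : R, 0 < e -> exists N, forall i, (N <= i)%N -> u i < e).
Proof.
move=> u0; rewrite cvgr0Pnorm_lt; split=> h e e0.
  have [N _ hN] := h e e0; exists N => i Ni.
  by have := hN i Ni; rewrite /= ger0_norm.
have [N hN] := h e e0; exists N => // i /= Ni.
by rewrite ger0_norm// hN.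
Qed.

Lemma inner_linear (a : R[i]) x y z :
  inner (a *: x + y) z = a * inner x z + inner y z.
Proof. by case: hH => h _ _ _ _; exact: h. Qed.

Lemma innerC x y : inner y x = (inner x y)^*%C.
Proof. by case: hH => _ h _ _ _; exact: h. Qed.

Lemma inner_ge0 x : 0 <= inner x x.
Proof. by case: hH. Qed.

Lemma inner_eq0 x : inner x x = 0 -> x = 0.
Proof. by case: hH => _ _ _ h _; exact: h. Qed.

Lemma innerDl x y z : inner (x + y) z = inner x z + inner y z.
Proof. by rewrite -[x]scale1r inner_linear mul1r scale1r. Qed.

Lemma inner0l z : inner 0 z = 0.
Proof. by apply: (addrI (inner 0 z)); rewrite -innerDl !addr0. Qed.

Lemma innerZl (a : R[i]) x z : inner (a *: x) z = a * inner x z.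
Proof. by rewrite -[a *: x]addr0 inner_linear inner0l addr0. Qed.

Lemma innerNl x z : inner (- x) z = - inner x z.
Proof. by rewrite -scaleN1r innerZl mulN1r. Qed.

Lemma innerBl x y z : inner (x - y) z = inner x z - inner y z.
Proof. by rewrite innerDl innerNl. Qed.

Lemma innerDr x y z : inner x (y + z) = inner x y + inner x z.
Proof. by rewrite innerC innerDl rmorphD /= -!innerC. Qed.

Lemma innerZr (a : R[i]) x z : inner x (a *: z) = a^*%C * inner x z.
Proof. by rewrite innerC innerZl rmorphM /= -innerC. Qed.

Lemma innerNr x z : inner x (- z) = - inner x z.
Proof. by rewrite innerC innerNl rmorphN /= -innerC. Qed.

Lemma innerBr x y z : inner x (y - z) = inner x y - inner x z.
Proof. by rewrite innerDr innerNr. Qed.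

Lemma inner0r z : inner z 0 = 0.
Proof. by rewrite innerC inner0l conjc0. Qed.

Lemma hnorm_ge0 x : 0 <= hnorm x. Proof. exact: sqrtr_ge0. Qed.

Lemma hnorm_sqC x : inner x x = (hnorm x ^+ 2)%:C.
Proof.
have := inner_ge0 x; rewrite /hnorm; case: (inner x x) => a b; rewrite lecE /=.
by move=> /andP[/eqP -> a0]; rewrite sqr_sqrtr.
Qed.

Lemma hnorm_sq x : hnorm x ^+ 2 = complex.Re (inner x x).
Proof. by rewrite hnorm_sqC. Qed.

Lemma hnorm0 : hnorm (0 : H) = 0.
Proof. by rewrite /hnorm inner0l sqrtr0. Qed.

Lemma hnorm_eq0 x : hnorm x = 0 -> x = 0.
Proof. by move=> h; apply: inner_eq0; rewrite hnorm_sqC h expr0n. Qed.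

Lemma hnormZ (a : R[i]) x : hnorm (a *: x) = normc a * hnorm x.
Proof.
apply/eqP; rewrite -(@eqrXn2 R 2) ?mulr_ge0 ?hnorm_ge0 ?normc_ge0//.
apply/eqP; apply: complexI; rewrite -hnorm_sqC innerZl innerZr mulrA mulc_conj.
by rewrite hnorm_sqC -rmorphM /= exprMn.
Qed.

Lemma hnormN x : hnorm (- x) = hnorm x.
Proof. by rewrite /hnorm innerNl innerNr opprK. Qed.

Lemma hnormBC x y : hnorm (x - y) = hnorm (y - x).
Proof. by rewrite -hnormN opprB. Qed.

Lemma cauchy_schwarz x y : normc (inner x y) <= hnorm x * hnorm y.
Proof.
have [y0|yn0] := eqVneq (hnorm y) 0.
  by rewrite (hnorm_eq0 y0) inner0r Normc.normc0 mulr_ge0 ?hnorm_ge0.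
have yp : 0 < hnorm y by rewrite lt_def yn0 hnorm_ge0.
set b := inner x y.
(* The residual of projecting [x] on [y], multiplied by the squared norm of [y] to avoid a
   division. *)
have := inner_ge0 ((hnorm y ^+ 2)%:C *: x - b *: y).
rewrite innerBl !innerBr !innerZl !innerZr (innerC x y) -/b !hnorm_sqC conjc_real.
have -> : (hnorm y ^+ 2)%:C * ((hnorm y ^+ 2)%:C * (hnorm x ^+ 2)%:C) -
    (hnorm y ^+ 2)%:C * (b^*%C * b) -
    (b * ((hnorm y ^+ 2)%:C * b^*%C) - b * (b^*%C * (hnorm y ^+ 2)%:C)) =
    (hnorm y ^+ 2)%:C * ((hnorm y ^+ 2)%:C * (hnorm x ^+ 2)%:C - b * b^*%C).
  by ring.
rewrite mulc_conj -!rmorphM -rmorphB -rmorphM /= ler0c pmulr_rge0 ?exprn_gt0//.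
rewrite subr_ge0 -exprMn mulrC ler_pXn2r// ?nnegrE ?mulr_ge0 ?normc_ge0 ?hnorm_ge0//.
Qed.

Lemma hnormD x y : hnorm (x + y) <= hnorm x + hnorm y.
Proof.
rewrite -(@ler_pXn2r R 2) ?nnegrE ?addr_ge0 ?hnorm_ge0//.
rewrite hnorm_sq innerDl !innerDr !ReD -!hnorm_sq (innerC x y) ReJ.
have := le_trans (ler_norm _) (le_trans (normc_Re _) (cauchy_schwarz x y)).
move=> h; rewrite sqrrD mulr2n; lra.
Qed.

Lemma hnormB x y : hnorm (x - y) <= hnorm x + hnorm y.
Proof. by rewrite -[in leRHS](hnormN y) hnormD. Qed.

Lemma hnorm_triangle y x z : hnorm (x - z) <= hnorm (x - y) + hnorm (y - z).
Proof. by rewrite -[x - z](subrKA y) hnormD. Qed.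

Lemma linear_map0 f : linear f -> f 0 = 0.
Proof.
by move=> lf; have := lf (-1) 0 0; rewrite scaler0 add0r scaleN1r addNr.
Qed.

Lemma linear_mapD f x y : linear f -> f (x + y) = f x + f y.
Proof. by move=> lf; have := lf 1 x y; rewrite !scale1r. Qed.

Lemma linear_mapZ f a x : linear f -> f (a *: x) = a *: f x.
Proof. by move=> lf; have := lf a x 0; rewrite (linear_map0 lf) !addr0. Qed.

Lemma linear_mapB f x y : linear f -> f (x - y) = f x - f y.
Proof. by move=> lf; rewrite linear_mapD// -scaleN1r linear_mapZ// scaleN1r. Qed.

Lemma bounded_op_ge0 f : bounded_op f ->
  exists M, 0 <= M /\ forall x, hnorm (f x) <= M * hnorm x.
Proof.
move=> [_ [M hM]]; exists (Num.max M 0); split; first by rewrite le_max lexx orbT.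
move=> x; rewrite (le_trans (hM x))// ler_wpM2r ?hnorm_ge0//.
by rewrite le_max lexx.
Qed.

Lemma bounded_op_lin (a : R[i]) f g : bounded_op f -> bounded_op g ->
  bounded_op (fun x => a *: f x + g x).
Proof.
move=> [lf [M hM]] [lg [N hN]]; split=> [b x y|].
  by rewrite lf lg scalerDr scalerDr !scalerA addrACA [a * b]mulrC.
exists (normc a * M + N) => x; rewrite (le_trans (hnormD _ _))// hnormZ mulrDl.
by rewrite lerD// -mulrA ler_wpM2l// normc_ge0.
Qed.

Lemma bounded_op_comp f g : bounded_op f -> bounded_op g -> bounded_op (f \o g).
Proof.
move=> bf [lg [N hN]]; have [M [M0 hM]] := bounded_op_ge0 bf.
split=> [b x y|]; first by rewrite /= lg (proj1 bf).
exists (M * N) => x /=; rewrite (le_trans (hM _))// -mulrA ler_wpM2l//.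
Qed.

(** Testing on [x = g y] gives [|g y|^2 = <f (g y), y> <= M |g y| |y|]. *)
Lemma adjoint_opnorm f g M : 0 <= M -> adjoint_of f g -> opnorm_le f M ->
  opnorm_le g M.
Proof.
move=> M0 fg fM y; have [->|gn0] := eqVneq (hnorm (g y)) 0.
  by rewrite mulr_ge0// hnorm_ge0.
have gp : 0 < hnorm (g y) by rewrite lt_def gn0 hnorm_ge0.
rewrite -(ler_pM2l gp) -expr2 hnorm_sq -fg.
rewrite (le_trans (ler_norm _))// (le_trans (normc_Re _))//.
rewrite (le_trans (cauchy_schwarz _ _))// mulrA [_ * M]mulrC ler_wpM2r ?hnorm_ge0//.
Qed.

Lemma adjoint_ofB f f' g g' : adjoint_of f g -> adjoint_of f' g' ->
  adjoint_of (fun x => f x - f' x) (fun x => g x - g' x).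
Proof. by move=> h h' x y; rewrite innerBl innerBr h h'. Qed.

(** The defect of linearity of [g] is orthogonal to every vector, in particular to itself, because
    the inner product is conjugate linear on the right. *)
Lemma adjoint_linear f g : adjoint_of f g -> linear g.
Proof.
move=> fg a y z; apply/eqP; rewrite -subr_eq0; apply/eqP; apply: inner_eq0.
rewrite [X in inner _ X]/GRing.add /=.
set d := (X in inner X _).
by rewrite innerBr -fg !innerDr !innerZr -!fg subrr.
Qed.

Lemma op_closure_sub (B : set (H -> H)) : B `<=` @bounded_op R H -> B `<=` op_closure B.
Proof.
move=> Bb f Bf; split; first exact: Bb.
by move=> e e0; exists f; split=> // x; rewrite subrr hnorm0 mulr_ge0 ?hnorm_ge0// ltW.
Qed.

(** With [C] the closure itself this is idempotence; with [C] the image of [ell1] it reduces density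
    to the approximation of single convolution operators. *)
Lemma op_closureS (B C : set (H -> H)) : C `<=` op_closure B ->
  op_closure C `<=` op_closure B.
Proof.
move=> CB f [bf hf]; split=> // e e0.
have e2 : 0 < e / 2 by rewrite divr_gt0.
have [g [Cg fg]] := hf _ e2; have [_ hg] := CB g Cg.
have [k [Bk gk]] := hg _ e2; exists k; split=> // x.
rewrite (le_trans (hnorm_triangle (g x) _ _))//.
by rewrite [e]splitr mulrDl lerD.
Qed.

Lemma op_closure_lin (B : set (H -> H)) (a : R[i]) f g :
  (forall b h k, B h -> B k -> B (fun x => b *: h x + k x)) ->
  op_closure B f -> op_closure B g -> op_closure B (fun x => a *: f x + g x).
Proof.
move=> Blin [bf hf] [bg hg]; split=> [|e e0]; first exact: bounded_op_lin.
(* The added [1] keeps the divisor positive when [a = 0]. *)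
have a1 : 0 < normc a + 1 by rewrite ltr_wpDl ?normc_ge0.
have e1 : 0 < e / 2 / (normc a + 1) by rewrite !divr_gt0.
have e2 : 0 < e / 2 by rewrite divr_gt0.
have [f' [Bf' ff']] := hf _ e1; have [g' [Bg' gg']] := hg _ e2.
exists (fun x => a *: f' x + g' x); split=> [|x]; first exact: Blin.
rewrite opprD addrACA -scalerBr (le_trans (hnormD _ _))// hnormZ.
rewrite [e]splitr mulrDl lerD//.
rewrite (le_trans (ler_wpM2l (normc_ge0 _) (ff' x)))// mulrA.
rewrite ler_wpM2r ?hnorm_ge0// mulrCA ler_piMr ?(ltW e2)//.
by rewrite ler_pdivrMr// mul1r lerDl.
Qed.

Lemma op_closure_comp (B : set (H -> H)) f g : B `<=` @bounded_op R H ->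
  (forall h k, B h -> B k -> B (h \o k)) ->
  op_closure B f -> op_closure B g -> op_closure B (f \o g).
Proof.
move=> Bb Bcomp [bf hf] [bg hg]; split=> [|e e0]; first exact: bounded_op_comp.
have [M [M0 hM]] := bounded_op_ge0 bf.
have M1 : 0 < M + 1 by rewrite ltr_wpDl.
have e1 : 0 < e / 2 / (M + 1) by rewrite !divr_gt0.
(* [g'] is chosen first: the accuracy required of [f'] depends on the bound [N] of [g']. *)
have [g' [Bg' gg']] := hg _ e1.
have [N [N0 hN]] := bounded_op_ge0 (Bb _ Bg').
have N1 : 0 < N + 1 by rewrite ltr_wpDl.
have e2 : 0 < e / 2 / (N + 1) by rewrite !divr_gt0.
have [f' [Bf' ff']] := hf _ e2.
exists (f' \o g'); split=> [|x]; first exact: Bcomp.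
rewrite (le_trans (hnorm_triangle (f (g' x)) _ _))//= -linear_mapB; last exact: (proj1 bf).
rewrite [e]splitr mulrDl lerD//.
  rewrite (le_trans (hM _))// (le_trans (ler_wpM2l M0 (gg' x)))// mulrA.
  rewrite ler_wpM2r ?hnorm_ge0// mulrCA ler_piMr//; first by rewrite divr_ge0// ltW.
  by rewrite ler_pdivrMr// mul1r lerDl.
rewrite (le_trans (ff' _))// (le_trans (ler_wpM2l (ltW e2) (hN x)))// mulrA.
rewrite ler_wpM2r ?hnorm_ge0// -(mulrA (e / 2)) ler_piMr//; first by rewrite divr_ge0// ltW.
by rewrite mulrC ler_pdivrMr// mul1r lerDl.
Qed.

Lemma ltr_invS (e : R) : 0 < e -> exists n : nat, n.+1%:R^-1 < e.
Proof.
move=> e0; exists (Num.truncn e^-1).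
by rewrite invf_plt ?posrE// truncnS_gt.
Qed.

(* The adjoint of a norm limit is the pointwise limit of the adjoints. *)
Lemma op_closure_adjoint (B : set (H -> H)) f :
  (forall h, B h -> exists k, B k /\ adjoint_of h k) ->
  op_closure B f -> exists g, op_closure B g /\ adjoint_of f g.
Proof.
move=> Badj [bf hf].
pose r (n : nat) : R := n.+1%:R^-1.
have r0 n : 0 < r n by rewrite invr_gt0.
have rle i j : (i <= j)%N -> r j <= r i.
  by move=> ij; rewrite lef_pV2 ?posrE// ler_nat.
have /choice[F hF] : forall n, exists F, B F /\ opnorm_le (fun x => f x - F x) (r n).
  by move=> n; exact: hf.
have /choice[G hG] : forall n, exists G, B G /\ adjoint_of (F n) G.
  by move=> n; apply: Badj; have [] := hF n.
have FF i j : opnorm_le (fun x => F i x - F j x) (r i + r j).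
  move=> x; rewrite (le_trans (hnorm_triangle (f x) _ _))// mulrDl lerD//.
    by rewrite hnormBC; exact: (proj2 (hF i)).
  exact: (proj2 (hF j)).
have GG i j : opnorm_le (fun x => G i x - G j x) (r i + r j).
  apply: (@adjoint_opnorm (fun x => F i x - F j x)) => //.
    by rewrite addr_ge0// ltW.
  by apply: adjoint_ofB; [exact: (proj2 (hG i))|exact: (proj2 (hG j))].
have /choice[g hg] : forall y, exists l, hnorm (G i y - l) @[i --> \oo] --> (0 : R).
  move=> y; case: hH => _ _ _ _; apply => e e0.
  have y1 : 0 < 2 * (hnorm y + 1) by rewrite mulr_gt0// ltr_wpDl ?hnorm_ge0.
  have [N hN] := ltr_invS (divr_gt0 e0 y1); exists N => i j Ni Nj.
  rewrite (le_lt_trans (GG i j y))//.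
  rewrite (@le_lt_trans _ _ (r N * (2 * (hnorm y + 1))))//; last by rewrite -ltr_pdivlMr.
  rewrite mulrA ler_pM ?addr_ge0 ?hnorm_ge0 ?lerDl// ?(ltW (r0 _))//.
  by rewrite mulr_natr mulr2n lerD// rle.
(* [GG i j] for a late index [j] whose distance to the limit is below [e]; the second [r i] absorbs
   [r j]. *)
have Gg i y : hnorm (G i y - g y) <= (r i + r i) * hnorm y.
  apply/ler_addgt0Pr => e e0.
  have := hg y; rewrite seq_cvg0P; last by move=> ?; exact: hnorm_ge0.
  move=> /(_ e e0)[N hN]; have := hN (maxn i N) (leq_maxr _ _) => h.
  rewrite (le_trans (hnorm_triangle (G (maxn i N) y) _ _))// lerD ?(ltW h)//.
  rewrite (le_trans (GG _ _ _))// ler_wpM2r ?hnorm_ge0// lerD2l rle//.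
  exact: leq_maxl.
have fg : adjoint_of f g.
  move=> x y; apply/eqP; rewrite -subr_eq0; apply/eqP/Normc.eq0_normc/eqP.
  rewrite eq_le normc_ge0 andbT; apply/ler_addgt0Pr => e e0; rewrite add0r.
  set K := hnorm x * hnorm y.
  have K0 : 0 <= K by rewrite mulr_ge0 ?hnorm_ge0.
  (* Three errors of size [r N * K] will occur: one from [f - F N], two from the bound [r N + r N]
     on [G N - g]. *)
  have K1 : 0 < 3 * (K + 1) by rewrite mulr_gt0// ltr_wpDl.
  have [N hN] := ltr_invS (divr_gt0 e0 K1).
  have -> : inner (f x) y - inner x (g y) =
      inner (f x - F N x) y + inner x (G N y - g y).
    by rewrite innerBl innerBr (proj2 (hG N)) addrA subrK.
  rewrite (le_trans (le_normcD _ _))//.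
  have h1 : normc (inner (f x - F N x) y) <= r N * K.
    rewrite (le_trans (cauchy_schwarz _ _))// /K mulrA ler_wpM2r ?hnorm_ge0//.
    exact: (proj2 (hF N)).
  have h2 : normc (inner x (G N y - g y)) <= (r N + r N) * K.
    rewrite (le_trans (cauchy_schwarz _ _))// /K mulrCA ler_wpM2l ?hnorm_ge0//.
  have h3 : r N * (3 * (K + 1)) < e by rewrite -ltr_pdivlMr.
  have := r0 N; nra.
exists g; split=> //; split.
  split; first exact: adjoint_linear fg.
  by have [M [M0 hM]] := bounded_op_ge0 bf; exists M; exact: adjoint_opnorm hM.
move=> e e0; have [N hN] := ltr_invS (divr_gt0 e0 (ltr0Sn R 1)).
exists (G N); split; first by have [] := hG N.
move=> y; rewrite hnormBC (le_trans (Gg N y))// ler_wpM2r ?hnorm_ge0//.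
by move: hN; rewrite -/(r N); lra.
Qed.

Lemma op_closure_cstar (B : set (H -> H)) : star_subalgebra B ->
  cstar_algebra (op_closure B).
Proof.
move=> [Bb B0 Blin Bcomp Badj]; split; last exact: op_closureS.
split.
- by move=> f [].
- exact: op_closure_sub.
- by move=> a f g; exact: op_closure_lin.
- by move=> f g; exact: op_closure_comp.
- by move=> f; exact: op_closure_adjoint.
Qed.

End HilbertTheory.

(** * Direct sums of Hilbert spaces *)

Section DirectSumTheory.
Context {R : realType} (H K : ipSpace R).
Context (hH : is_hilbert H) (hK : is_hilbert K).

Lemma dsum_innerE (x y : dsum H K) : inner x y = inner x.1 y.1 + inner x.2 y.2.
Proof. by []. Qed.

Lemma dsum_hnorm_sq (x : dsum H K) : hnorm x ^+ 2 = hnorm x.1 ^+ 2 + hnorm x.2 ^+ 2.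
Proof.
rewrite [in LHS]/hnorm dsum_innerE ReD sqr_sqrtr ?(hnorm_sq hH) ?(hnorm_sq hK)//.
by rewrite -!hnorm_sq// addr_ge0// sqr_ge0.
Qed.

Lemma dsum_hnorm1 (x : dsum H K) : hnorm x.1 <= hnorm x.
Proof.
rewrite -(@ler_pXn2r R 2) ?nnegrE ?hnorm_ge0// dsum_hnorm_sq lerDl sqr_ge0//.
Qed.

Lemma dsum_hnorm2 (x : dsum H K) : hnorm x.2 <= hnorm x.
Proof.
rewrite -(@ler_pXn2r R 2) ?nnegrE ?hnorm_ge0// dsum_hnorm_sq lerDr sqr_ge0//.
Qed.

Lemma dsum_hnorm_le (x : dsum H K) : hnorm x <= hnorm x.1 + hnorm x.2.
Proof.
rewrite -(@ler_pXn2r R 2) ?nnegrE ?addr_ge0 ?hnorm_ge0// dsum_hnorm_sq.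
have := mulr_ge0 (hnorm_ge0 x.1) (hnorm_ge0 x.2); rewrite sqrrD mulr2n; lra.
Qed.

Lemma dsum_hilbert : is_hilbert (dsum H K).
Proof.
split.
- move=> a x y z; rewrite !dsum_innerE /= (inner_linear hH) (inner_linear hK).
  by ring.
- by move=> x y; rewrite !dsum_innerE rmorphD /= -(innerC hH) -(innerC hK).
- by move=> x; rewrite dsum_innerE addr_ge0// inner_ge0.
- move=> x; rewrite dsum_innerE => /eqP.
  rewrite paddr_eq0 ?inner_ge0// => /andP[/eqP/(inner_eq0 hH) e1 /eqP/(inner_eq0 hK) e2].
  by rewrite (surjective_pairing x) e1 e2.
- move=> u cu.
  have [l1 h1] : exists l, hnorm ((u i).1 - l) @[i --> \oo] --> (0 : R).
    case: hH => _ _ _ _; apply => e /cu[N hN]; exists N => i j Ni Nj.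
    by apply: le_lt_trans (hN i j Ni Nj); exact: (dsum_hnorm1 (u i - u j)).
  have [l2 h2] : exists l, hnorm ((u i).2 - l) @[i --> \oo] --> (0 : R).
    case: hK => _ _ _ _; apply => e /cu[N hN]; exists N => i j Ni Nj.
    by apply: le_lt_trans (hN i j Ni Nj); exact: (dsum_hnorm2 (u i - u j)).
  exists (l1, l2); move: h1 h2; rewrite !seq_cvg0P; try by move=> ?; exact: hnorm_ge0.
  move=> h1 h2 e e0; have e2 : 0 < e / 2 by rewrite divr_gt0.
  have [N1 hN1] := h1 _ e2; have [N2 hN2] := h2 _ e2.
  exists (maxn N1 N2) => i; rewrite geq_max => /andP[i1 i2].
  rewrite (le_lt_trans (dsum_hnorm_le _))// [e]splitr ltrD//.
    exact: hN1.
  exact: hN2.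
Qed.

End DirectSumTheory.

(** * The Hilbert space l^2 *)

Section RealCauchy.
Context {R : realType}.

Lemma real_cauchy_lim (a : nat -> R) :
  (forall e, 0 < e -> exists N, forall i j, (N <= i)%N -> (N <= j)%N ->
     `|a i - a j| < e) ->
  exists l, forall e, 0 < e -> exists N, forall i, (N <= i)%N -> `|a i - l| < e.
Proof.
move=> ca; have /cauchy_cvgP/cvg_ex[l hl] : cauchy (a @ \oo).
  apply: cauchy_exP => e /ca[N hN]; exists (a N); exists N => // i /= Ni.
  exact: hN.
exists l => e e0; have /cvgrPdist_lt/(_ e e0)[N _ hN] := hl.
by exists N => i Ni; rewrite distrC; exact: hN.
Qed.

End RealCauchy.

Section Ell2.
Context {R : realType} {I : choiceType}.
Implicit Types f g : ell2 R I.

Definition sqsummable (f : I -> R[i]) := rsummable (fun i => normc (f i) ^+ 2).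

Definition seq_of (f : ell2 R I) : I -> R[i] := val (f : ell2_seq R I).

Lemma square_summableP (f : I -> R[i]) : (f \in @square_summable R I) <-> sqsummable f.
Proof.
rewrite unfold_in /sqsummable /rsummable /summable /=.
have -> : (\esum_(x in [set: I]) `|normc (f x) ^+ 2|%:E =
  \esum_(x in [set: I]) (normc (f x) ^+ 2)%:E)%E.
  by apply: eq_esum => i _; rewrite ger0_norm ?sqr_ge0.
by split=> /asboolP.
Qed.

Definition mk_ell2 (f : I -> R[i]) (h : sqsummable f) : ell2 R I :=
  exist _ f ((square_summableP f).2 h).

Lemma mk_ell2E (f : I -> R[i]) (h : sqsummable f) : seq_of (mk_ell2 h) = f.
Proof. by []. Qed.

Lemma seq_of_inj f g : seq_of f = seq_of g -> f = g.
Proof. exact: val_inj. Qed.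

Lemma seq_ofL (a : R[i]) f g i : seq_of (a *: f + g) i = a * seq_of f i + seq_of g i.
Proof. by []. Qed.

Lemma seq_ofD f g i : seq_of (f + g) i = seq_of f i + seq_of g i.
Proof. by []. Qed.

Lemma seq_ofZ (a : R[i]) f i : seq_of (a *: f) i = a * seq_of f i.
Proof. by []. Qed.

Lemma seq_ofB f g i : seq_of (f - g) i = seq_of f i - seq_of g i.
Proof. by []. Qed.

Lemma seq_of0 i : seq_of 0 i = 0.
Proof. by []. Qed.

Lemma ell2_sqsummable f : sqsummable (seq_of f).
Proof. exact/square_summableP/(valP (f : ell2_seq R I)). Qed.

Lemma ell2_innerE f g : inner f g = csum (fun i => seq_of f i * (seq_of g i)^*%C).
Proof. by []. Qed.

Lemma ell2_inner_summable f g : csummable (fun i => seq_of f i * (seq_of g i)^*%C).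
Proof.
have h := rsummableZ (2^-1) (rsummableD (ell2_sqsummable f) (ell2_sqsummable g)).
apply: csummable_le h => i; rewrite Normc.normcM normc_conj mulrC.
by rewrite [leRHS]mulrC [X in _ <= X / _]addrC mul_le_sq.
Qed.

Lemma ell2_inner_sq f : inner f f = (rsum (fun i => normc (seq_of f i) ^+ 2))%:C.
Proof.
rewrite ell2_innerE -csum_real; congr csum; apply/funext => i.
by rewrite mulc_conj.
Qed.

Lemma ell2_hnorm_sq f : hnorm f ^+ 2 = rsum (fun i => normc (seq_of f i) ^+ 2).
Proof.
rewrite /hnorm ell2_inner_sq /= sqr_sqrtr//.
by apply: rsum_ge0 => i; rewrite sqr_ge0.
Qed.

Lemma ell2_coord f i : normc (seq_of f i) <= hnorm f.
Proof.
rewrite -(@ler_pXn2r R 2) ?nnegrE ?normc_ge0 ?hnorm_ge0// ell2_hnorm_sq.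
apply: (@rsum_ge1 _ _ (fun i => normc (seq_of f i) ^+ 2)).
  exact: ell2_sqsummable.
by move=> j; rewrite sqr_ge0.
Qed.

Lemma ell2_hnorm_le f (M : R) : 0 <= M ->
  (forall F : set I, finite_set F -> \sum_(i \in F) normc (seq_of f i) ^+ 2 <= M ^+ 2) ->
  hnorm f <= M.
Proof.
move=> M0 h; rewrite -(@ler_pXn2r R 2) ?nnegrE ?hnorm_ge0// ell2_hnorm_sq.
by apply: (rsum_le_fin _ h).2 => i; rewrite sqr_ge0.
Qed.

Lemma ell2_cauchy_seq (u : nat -> ell2 R I) :
  (forall e : R, 0 < e -> exists N, forall i j,
     (N <= i)%N -> (N <= j)%N -> hnorm (u i - u j) < e) ->
  exists g : I -> R[i], forall i e, 0 < e -> exists N, forall n, (N <= n)%N ->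
    normc (seq_of (u n) i - g i) < e.
Proof.
move=> cu; have coord (p : R[i] -> R) : (forall z, `|p z| <= normc z) ->
    (forall z w, p (z - w) = p z - p w) -> forall i, exists l, forall e, 0 < e ->
    exists N, forall n, (N <= n)%N -> `|p (seq_of (u n) i) - l| < e.
  move=> ple pB i; apply: real_cauchy_lim => e /cu[N hN]; exists N => n m Nn Nm.
  rewrite -pB -seq_ofB (le_lt_trans (ple _))// (le_lt_trans (ell2_coord _ _))//.
  exact: hN.
have ReB (z w : R[i]) : complex.Re (z - w) = complex.Re z - complex.Re w.
  by case: z; case: w.
have ImB (z w : R[i]) : complex.Im (z - w) = complex.Im z - complex.Im w.
  by case: z; case: w.
have /choice[a ha] := coord (@complex.Re R) (@normc_Re R) ReB.
have /choice[b hb] := coord (@complex.Im R) (@normc_Im R) ImB.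
exists (fun i => a i +i* b i) => i e e0; have e2 : 0 < e / 2 by rewrite divr_gt0.
have [N1 h1] := ha i _ e2; have [N2 h2] := hb i _ e2.
exists (maxn N1 N2) => n; rewrite geq_max => /andP[n1 n2].
rewrite (le_lt_trans (normc_le_ReIm _))// ReB ImB [e]splitr ltrD//; [exact: h1|exact: h2].
Qed.

Lemma ell2_cauchy_fsum (u : nat -> ell2 R I) (g : I -> R[i]) (s : seq I) :
  (forall i e, 0 < e -> exists N, forall n, (N <= n)%N ->
    normc (seq_of (u n) i - g i) < e) ->
  forall e, 0 < e -> exists N, forall n, (N <= n)%N ->
    \sum_(i <- s) normc (seq_of (u n) i - g i) ^+ 2 < e.
Proof.
move=> hg; elim: s => [|i s ih] e e0; first by exists 0%N => n _; rewrite big_nil.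
have e2 : 0 < e / 2 by rewrite divr_gt0.
have [N1 h1] := ih _ e2.
(* A number below both [1] and [e / 2] has its square below [e / 2]. *)
have m0 : 0 < Num.min 1 (e / 2) by rewrite lt_min ltr01.
have [N2 h2] := hg i _ m0.
exists (maxn N1 N2) => n; rewrite geq_max => /andP[n1 n2].
rewrite big_cons [e]splitr ltrD ?h1//.
have := h2 n n2; rewrite lt_min => /andP[l1 l2].
by rewrite (le_lt_trans _ l2)// expr2 ler_piMr ?normc_ge0// ltW.
Qed.

(** The coordinatewise limit [g] is not known to lie in [ell2] beforehand. The finite partial sums
    of [|u n - g|^2] are bounded uniformly, which shows at once that [u n - g] is square summable
    and that its norm is small. *)
Lemma ell2_complete (u : nat -> ell2 R I) :
  (forall e : R, 0 < e -> exists N, forall i j,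
     (N <= i)%N -> (N <= j)%N -> hnorm (u i - u j) < e) ->
  exists l, hnorm (u i - l) @[i --> \oo] --> (0 : R).
Proof.
move=> cu; have [g hg] := ell2_cauchy_seq cu.
have key e : 0 < e -> exists N, forall n, (N <= n)%N -> forall F : set I,
    finite_set F -> \sum_(i \in F) normc (seq_of (u n) i - g i) ^+ 2 <= (2 * e) ^+ 2.
  move=> e0; have [N hN] := cu e e0; exists N => n Nn F finF.
  rewrite fsbig_finite//=; set s := finmap.enum_fset (fset_set F).
  have [N' hN'] := ell2_cauchy_fsum s hg (exprn_gt0 2 e0).
  (* The intermediate [u j] depends on the finite set [F], but the resulting bound
     [2 e^2 + 2 e^2 = (2 e)^2] does not. *)
  pose j := maxn N N'.
  have h1 := hN' j (leq_maxr _ _).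
  have h2 : \sum_(i <- s) normc (seq_of (u n) i - seq_of (u j) i) ^+ 2 <= e ^+ 2.
    have := hN n j Nn (leq_maxl _ _); set d := u n - u j => dl.
    apply: (@le_trans _ _ (hnorm d ^+ 2)); last first.
      by rewrite ler_pXn2r ?nnegrE ?hnorm_ge0 ?(ltW e0)// ltW.
    rewrite ell2_hnorm_sq.
    have := @rsum_fin_le R I (fun i => normc (seq_of d i) ^+ 2) F (ell2_sqsummable d)
      (fun i => sqr_ge0 _) finF.
    by rewrite fsbig_finite.
  have : \sum_(i <- s) normc (seq_of (u n) i - g i) ^+ 2 <=
      2 * \sum_(i <- s) normc (seq_of (u n) i - seq_of (u j) i) ^+ 2 +
      2 * \sum_(i <- s) normc (seq_of (u j) i - g i) ^+ 2.
    rewrite !big_distrr -big_split /=; apply: ler_sum => i _.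
    by rewrite -{1}(subrKA (seq_of (u j) i)) normcD2.
  by rewrite expr2 in h1 h2 *; lra.
have [N0 h0] := key 1 ltr01.
have sd : sqsummable (fun i => seq_of (u N0) i - g i).
  by apply: (rsum_le_fin _ (h0 N0 (leqnn _))).1 => i; rewrite sqr_ge0.
(* [mk_ell2 sd] is [u N0 - g], so this vector has the coordinates of [g]. *)
exists (u N0 - mk_ell2 sd); apply/seq_cvg0P => [i|e e0]; first exact: hnorm_ge0.
have e4 : 0 < e / 4 by rewrite divr_gt0.
have [N hN] := key _ e4; exists N => n Nn.
apply: (@le_lt_trans _ _ (2 * (e / 4))); last by lra.
apply: ell2_hnorm_le; first by rewrite mulr_ge0// ltW.
move=> F finF; apply: le_trans (hN n Nn F finF).
rewrite !fsbig_finite//=; apply: ler_sum => i _.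
by rewrite !seq_ofB mk_ell2E subKr.
Qed.

Lemma ell2_hilbert : is_hilbert (ell2 R I).
Proof.
split; last exact: ell2_complete.
- move=> a x y z; rewrite !ell2_innerE -csumZ; last exact: ell2_inner_summable.
  rewrite -csumD; [|exact/csummableZ/ell2_inner_summable|exact: ell2_inner_summable].
  by congr csum; apply/funext => i; rewrite seq_ofL; ring.
- move=> x y; rewrite !ell2_innerE -csumJ; last exact: ell2_inner_summable.
  by congr csum; apply/funext => i; rewrite rmorphM /= conjcK mulrC.
- by move=> x; rewrite ell2_inner_sq ler0c rsum_ge0// => i; rewrite sqr_ge0.
- move=> x; rewrite ell2_inner_sq => -[h]; apply: seq_of_inj; apply/funext => i.
  apply/Normc.eq0_normc/eqP; rewrite -(@eqrXn2 R 2) ?normc_ge0// expr0n /=.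
  rewrite eq_le sqr_ge0 andbT -[leRHS]h.
  apply: (@rsum_ge1 _ _ (fun i => normc (seq_of x i) ^+ 2)).
    exact: ell2_sqsummable.
  by move=> j; rewrite sqr_ge0.
Qed.

Lemma delta_sqsummable i : sqsummable (fun j => (j == i)%:R).
Proof.
apply: (@rsum_single R I _ i _).1 => j /negbTE ->.
by rewrite Normc.normc0 expr0n.
Qed.

Definition ell2_delta i : ell2 R I := mk_ell2 (delta_sqsummable i).

Lemma ell2_deltaE i j : seq_of (ell2_delta i) j = (j == i)%:R. Proof. by []. Qed.

Lemma inner_delta f i : inner (ell2_delta i) f = (seq_of f i)^*%C.
Proof.
rewrite ell2_innerE (@csum_single R I _ i).
  by rewrite ell2_deltaE eqxx mul1r.
by move=> j /negbTE ji; rewrite ell2_deltaE ji mul0r.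
Qed.

Lemma inner_real f g (d : I -> R) : (forall i, seq_of g i = (d i)%:C * seq_of f i) ->
  inner g f = (rsum (fun i => d i * normc (seq_of f i) ^+ 2))%:C.
Proof.
move=> gE; rewrite ell2_innerE -csum_real; congr csum; apply/funext => i.
by rewrite gE -mulrA mulc_conj -rmorphM.
Qed.

Lemma sqsummable_le (f : I -> R[i]) g (c : R) :
  (forall i, normc (f i) <= c * normc (seq_of g i)) -> sqsummable f.
Proof.
move=> fg; apply: rsummable_le (rsummableZ (c ^+ 2) (ell2_sqsummable g)) => i.
rewrite ger0_norm ?sqr_ge0// -exprMn ler_pXn2r ?nnegrE ?normc_ge0//.
exact: le_trans (normc_ge0 _) (fg i).
Qed.

Lemma ell2_trunc f (e : R) : 0 < e -> exists F : set I, finite_set F /\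
  forall g, (forall i, seq_of g i = if i \in F then seq_of f i else 0) ->
  hnorm (f - g) < e.
Proof.
move=> e0; have [F [finF hF]] := @rsum_tail R I _ (e ^+ 2) (ell2_sqsummable f)
  (fun i => sqr_ge0 _) (exprn_gt0 2 e0).
exists F; split=> // g gE; rewrite -(@ltr_pXn2r R 2) ?nnegrE ?hnorm_ge0 ?(ltW e0)//.
rewrite ell2_hnorm_sq; apply: le_lt_trans hF; rewrite le_eqVlt; apply/orP; left.
apply/eqP; congr rsum; apply/funext => i; rewrite seq_ofB gE.
by case: ifP => _; rewrite ?subrr ?subr0// Normc.normc0 expr0n.
Qed.

Lemma mulopE (d : I -> R[i]) (x y : ell2 R I) :
  mulop d (x, y) <-> forall l, seq_of y l = d l * seq_of x l.
Proof. by []. Qed.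

End Ell2.

(** * Kernel operators *)

Section MoreSums.
Context {R : realType} {I J : choiceType}.

Lemma finite_support_rsummable (F : set I) (f : I -> R) : finite_set F ->
  (forall i, i \notin F -> f i = 0) -> rsummable f.
Proof.
move=> finF h; rewrite /rsummable /summable.
have -> : (\esum_(x in [set: I]) `|(EFin \o f) x| = \esum_(x in F) `|f x|%:E)%E.
  rewrite [RHS]esum_mkcond; apply: eq_esum => i _ /=; case: ifPn => // /h ->.
  by rewrite normr0.
by rewrite esum_fset// fsumEFin// ltry.
Qed.

Lemma rsummable2_prod (f : I -> R) (g : J -> R) : rsummable f -> rsummable g ->
  rsummable2 (fun i j => f i * g j).
Proof.
move=> sf sg; have sg' := rsummable_norm sg.
have h : rsummable2 (fun i j => `|f i| * `|g j|).
  apply: rsummable2I => [i j|i|]; first by rewrite mulr_ge0.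
    exact: rsummableZ.
  have -> : (fun i => rsum (fun j => `|f i| * `|g j|)) =
      (fun i => rsum (fun j => `|g j|) * `|f i|).
    by apply/funext => i; rewrite rsumZ// mulrC.
  exact/rsummableZ/rsummable_norm.
by apply: rsummable2_le h => i j; rewrite normrM.
Qed.

Lemma rsummable2D (f g : I -> J -> R) : rsummable2 f -> rsummable2 g ->
  rsummable2 (fun i j => f i j + g i j).
Proof.
move=> sf sg; have := lte_add_pinfty sf sg.
rewrite -esumD; [|by move=> i _; apply: esum_ge0 => j _; rewrite lee_fin|
  by move=> i _; apply: esum_ge0 => j _; rewrite lee_fin].
apply: le_lt_trans; apply: le_esum => i _.
rewrite -esumD; [|by move=> j _; rewrite lee_fin|by move=> j _; rewrite lee_fin].
by apply: le_esum => j _; rewrite -EFinD lee_fin ler_normD.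
Qed.

Lemma rsummable2Z (c : R) (f : I -> J -> R) : rsummable2 f ->
  rsummable2 (fun i j => c * f i j).
Proof.
move=> sf; have f0 i j : 0 <= `|f i j| by [].
have sf' : rsummable2 (fun i j => `|f i j|).
  by apply: le_lt_trans sf; apply: le_esum => i _; apply: le_esum => j _; rewrite normr_id.
have [s1 _] := rsummable2_out f0 sf'.
have h : rsummable2 (fun i j => `|c| * `|f i j|).
  apply: rsummable2I => [i j|i|]; first by rewrite mulr_ge0.
    by apply: rsummableZ; exact: (rsummable2_row i sf').
  have -> : (fun i => rsum (fun j => `|c| * `|f i j|)) =
      (fun i => `|c| * rsum (fun j => `|f i j|)).
    by apply/funext => i; rewrite rsumZ//; exact: (rsummable2_row i sf').
  exact: rsummableZ.
by apply: rsummable2_le h => i j; rewrite normrM.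
Qed.

End MoreSums.

(** * Sums over a group and kernel operators *)

Section GroupSums.
Context {R : realType} {G : zmodType}.

Lemma subr_bij (m : G) : bijective (fun l => l - m).
Proof. by exists (fun l => l + m) => l; rewrite ?addrK ?subrK. Qed.

Lemma addr_bij (m : G) : bijective (fun l => l + m).
Proof. by exists (fun l => l - m) => l; rewrite ?addrK ?subrK. Qed.

Lemma oppr_bij : bijective (fun l : G => - l).
Proof. by exists (fun l => - l) => l; rewrite opprK. Qed.

(** Summing over [l] first, translation invariance turns the sum for fixed [m] into
    [f m * rsum g]. *)
Lemma rsummable2_conv (f g : G -> R) : (forall i, 0 <= f i) -> (forall i, 0 <= g i) ->
  rsummable f -> rsummable g -> rsummable2 (fun l m => f m * g (l - m)) /\
  rsum (fun l => rsum (fun m => f m * g (l - m))) = rsum f * rsum g.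
Proof.
move=> f0 g0 sf sg.
have gm m : rsummable (fun l => g (l - m)).
  exact: (reindex_rsummable (subr_bij m) sg).
have E m : rsum (fun l => g (l - m)) = rsum g.
  exact: (reindex_rsum g (subr_bij m)).
have h : rsummable2 (fun m l => f m * g (l - m)).
  apply: rsummable2I => [m l|m|]; first by rewrite mulr_ge0.
    exact: rsummableZ.
  have -> : (fun m => rsum (fun l => f m * g (l - m))) = (fun m => rsum g * f m).
    by apply/funext => m; rewrite rsumZ// E mulrC.
  exact: rsummableZ.
split; first exact: (rsummable2_swap h).
rewrite -(@rsum_swap_ge0 R G G (fun m l => f m * g (l - m)))//.
  have -> : (fun m => rsum (fun l => f m * g (l - m))) = (fun m => rsum g * f m).
    by apply/funext => m; rewrite rsumZ// E mulrC.
  by rewrite rsumZ// mulrC.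
by move=> m l; rewrite mulr_ge0.
Qed.

End GroupSums.

Section KernelOperators.
Context {R : realType} {G : zmodType}.
Implicit Types (K : G -> G -> R[i]) (alpha : G -> R).

(** [K l m] multiplies the input at [p = l - m], so both Schur sums of the moduli, over [m] at fixed
    [l] and over [l] at fixed [p], are at most [rsum alpha]. *)
Definition dominated K alpha :=
  rsummable alpha /\ forall l m, normc (K l m) <= alpha m.

Definition kconv K (f : G -> R[i]) : G -> R[i] :=
  fun l => csum (fun m => K l m * f (l - m)).

(** For a dominated kernel the default value [0] is never taken, by [kconv_young]. *)
Definition kop K (f : ell2 R G) : ell2 R G :=
  insubd (0 : ell2_seq R G) (kconv K (seq_of f)).

Lemma dominated_ge0 K alpha m : dominated K alpha -> 0 <= alpha m.
Proof. by move=> [_ h]; exact: le_trans (normc_ge0 _) (h 0 m). Qed.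

Lemma kconv_csummable K alpha (f : G -> R[i]) (M : R) l : dominated K alpha ->
  (forall l, normc (f l) <= M) -> csummable (fun m => K l m * f (l - m)).
Proof.
move=> [sa h] fM; apply: csummable_le (rsummableZ M sa) => m.
by rewrite Normc.normcM mulrC ler_pM ?normc_ge0.
Qed.

Lemma kop_csummable K alpha (f : ell2 R G) l : dominated K alpha ->
  csummable (fun m => K l m * seq_of f (l - m)).
Proof. by move=> dK; apply: (kconv_csummable _ dK) => j; exact: ell2_coord. Qed.

(* Cauchy-Schwarz for the weight [alpha], then Tonelli. *)
Lemma kconv_young K alpha (f : ell2 R G) : dominated K alpha ->
  sqsummable (kconv K (seq_of f)) /\
  rsum (fun l => normc (kconv K (seq_of f) l) ^+ 2) <= (rsum alpha * hnorm f) ^+ 2.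
Proof.
move=> dK; have a0 m := dominated_ge0 m dK; have [sa h] := dK.
pose g l := normc (seq_of f l) ^+ 2.
have g0 l : 0 <= g l by exact: sqr_ge0.
have [s2 e2] := rsummable2_conv a0 g0 sa (ell2_sqsummable f).
have ag0 l m : 0 <= alpha m * g (l - m) by rewrite mulr_ge0.
have [s1 _] := rsummable2_out ag0 s2.
have bound l : normc (kconv K (seq_of f) l) ^+ 2 <=
    rsum alpha * rsum (fun m => alpha m * g (l - m)).
  have [sag cs] := @weighted_cauchy_schwarz R G alpha
    (fun m => normc (seq_of f (l - m))) a0 (fun m => normc_ge0 _) sa
    (rsummable2_row l s2).
  apply: le_trans cs; rewrite ler_pXn2r ?nnegrE ?normc_ge0//; last first.
    by apply: rsum_ge0 => m; rewrite mulr_ge0// normc_ge0.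
  have sk := kop_csummable f l dK.
  rewrite (le_trans (normc_csum sk))//; apply: rsum_le => // m.
  by rewrite Normc.normcM ler_wpM2r// normc_ge0.
have s3 := rsummableZ (rsum alpha) s1.
have sq : sqsummable (kconv K (seq_of f)).
  by apply: rsummable_le s3 => l; rewrite ger0_norm ?sqr_ge0.
split=> //; rewrite (le_trans (rsum_le sq s3 bound))//.
by rewrite rsumZ// e2 exprMn ell2_hnorm_sq mulrA expr2.
Qed.

Lemma kopE K alpha (f : ell2 R G) : dominated K alpha ->
  seq_of (kop K f) = kconv K (seq_of f).
Proof.
move=> dK; rewrite /seq_of /kop insubdK//.
exact/square_summableP/(kconv_young f dK).1.
Qed.

(** Retains the unfolding of [kop], made opaque next, in order to identify [lconv] with a kernel
    operator. *)
Lemma kopEinsubd K f : kop K f = insubd (0 : ell2_seq R G) (kconv K (seq_of f)).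
Proof. by []. Qed.

Opaque kop.

Lemma kop_opnorm K alpha : dominated K alpha -> opnorm_le (kop K) (rsum alpha).
Proof.
move=> dK f; have r0 : 0 <= rsum alpha.
  by apply: rsum_ge0 => m; exact: dominated_ge0 dK.
rewrite -(@ler_pXn2r R 2) ?nnegrE ?mulr_ge0 ?hnorm_ge0//.
by rewrite ell2_hnorm_sq (kopE _ dK); exact: (kconv_young f dK).2.
Qed.

Lemma kop_bounded K alpha : dominated K alpha -> bounded_op (kop K).
Proof.
move=> dK; split; last by exists (rsum alpha); exact: kop_opnorm.
move=> a f g; apply: seq_of_inj; apply/funext => l.
rewrite seq_ofL (kopE f dK) (kopE g dK) (kopE (a *: f + g) dK).
have [sf sg] := (kop_csummable f l dK, kop_csummable g l dK).
rewrite /kconv -(csumZ a sf) -(csumD (csummableZ a sf) sg).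
by congr csum; apply/funext => m; rewrite seq_ofL mulrDr mulrCA.
Qed.

Lemma kop_linl (a : R[i]) K K' alpha alpha' : dominated K alpha ->
  dominated K' alpha' ->
  kop (fun l m => a * K l m + K' l m) = (fun f => a *: kop K f + kop K' f).
Proof.
move=> dK dK'.
have dS : dominated (fun l m => a * K l m + K' l m)
    (fun m => normc a * alpha m + alpha' m).
  split; first exact: rsummableD (rsummableZ _ dK.1) dK'.1.
  move=> l m; rewrite (le_trans (le_normcD _ _))// Normc.normcM lerD ?dK'.2//.
  by rewrite ler_wpM2l ?normc_ge0 ?dK.2.
apply/funext => f; apply: seq_of_inj; apply/funext => l.
rewrite seq_ofL (kopE f dK) (kopE f dK') (kopE f dS) /kconv.
have [sf sg] := (kop_csummable f l dK, kop_csummable f l dK').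
rewrite -(csumZ a sf) -(csumD (csummableZ a sf) sg).
by congr csum; apply/funext => m; rewrite mulrDl mulrA.
Qed.

(** The matrix entry of [kop K] from [p] to [l] is [K l (l - p)]; the formula for [K'] is its
    conjugate transpose. After Fubini, the substitutions [l + m] for [l] and [- m] for [m] match the
    two double sums. *)
Lemma kop_adjoint K K' alpha alpha' : dominated K alpha -> dominated K' alpha' ->
  (forall l m, K' l m = (K (l - m) (- m))^*%C) -> adjoint_of (kop K) (kop K').
Proof.
move=> dK dK' KE f g; have a0 m := dominated_ge0 m dK.
rewrite !ell2_innerE (kopE f dK) (kopE g dK').
pose X l m := K l m * seq_of f (l - m) * (seq_of g l)^*%C.
have sX : csummable2 X.
  (* Each term is at most [alpha m] times [|f (l - m)|^2 + |g l|^2], and both parts are doubly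
     summable. *)
  have s1 := (rsummable2_conv a0 (fun l => sqr_ge0 _) dK.1 (ell2_sqsummable f)).1.
  have s2 := rsummable2_swap (rsummable2_prod dK.1 (ell2_sqsummable g)).
  apply: rsummable2_le (rsummable2D s1 s2) => l m.
  rewrite ger0_norm ?normc_ge0// /X !Normc.normcM normc_conj -mulrA -mulrDr.
  rewrite ler_pM ?mulr_ge0 ?normc_ge0 ?dK.2//.
  rewrite (le_trans (mul_le_sq _ _))// ler_pdivrMr// ler_peMr ?ler1n//.
  by rewrite addr_ge0// sqr_ge0.
have sX' : csummable2 (fun m l => X (l + m) m).
  move: (rsummable2_swap sX); apply: le_lt_trans; apply: le_esum => m _.
  have sb : set_bij [set: G] [set: G] (fun l => l + m).
    by rewrite setTT_bijective; exact: addr_bij.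
  by rewrite [leRHS](reindex_esum _ _ _ _ sb).
transitivity (csum (fun l => csum (fun m => X l m))).
  congr csum; apply/funext => l; rewrite /kconv mulrC -csumZ; last exact: kop_csummable dK.
  by congr csum; apply/funext => m; rewrite /X mulrC.
rewrite csum_swap//.
transitivity (csum (fun m => csum (fun l => X (l + m) m))).
  by congr csum; apply/funext => m; rewrite (reindex_csum (fun l => X l m) (addr_bij m)).
rewrite csum_swap//; congr csum; apply/funext => l.
rewrite /kconv -csumJ; last exact: kop_csummable dK'.
rewrite -csumZ; last exact/csummableJ/(kop_csummable _ _ dK').
rewrite -(reindex_csum (fun m => X (l + m) m) oppr_bij).
congr csum; apply/funext => m.
by rewrite /X KE rmorphM /= conjcK opprK subrK; ring.
Qed.

Section Commutators.
Context (d : G -> R[i]) (K : G -> G -> R[i]) (alpha : G -> R) (beta : G -> R).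
Context (dK : dominated K alpha).
Context (dB : forall l m, normc (d l - d (l - m)) <= beta m).
Context (sab : rsummable (fun m => alpha m * beta m)).

Definition kernel_comm := fun l m => (d l - d (l - m)) * K l m.

Lemma kernel_comm_dominated : dominated kernel_comm (fun m => alpha m * beta m).
Proof.
split=> // l m; rewrite Normc.normcM mulrC ler_pM ?normc_ge0//.
exact: dK.2.
Qed.

(** Split [d l = d (l - m) + (d l - d (l - m))] under the sum. The identity shows both that
    [kop K x] stays in the domain of [mulop d] and what the commutator is. *)
Lemma kernel_commE (x y : ell2 R G) : (forall l, seq_of y l = d l * seq_of x l) ->
  forall l, d l * seq_of (kop K x) l = seq_of (kop K y) l + seq_of (kop kernel_comm x) l.
Proof.
move=> yE l; have dC := kernel_comm_dominated.
rewrite (kopE x dK) (kopE y dK) (kopE x dC) /kconv.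
rewrite -(csumZ (d l) (kop_csummable x l dK)).
rewrite -(csumD (kop_csummable y l dK) (kop_csummable x l dC)).
by congr csum; apply/funext => m; rewrite yE /kernel_comm; ring.
Qed.

End Commutators.

Lemma kop_commutator_ext (d : G -> R[i]) K alpha beta : dominated K alpha ->
  (forall l m, normc (d l - d (l - m)) <= beta m) ->
  rsummable (fun m => alpha m * beta m) ->
  commutator_ext (mulop d) (kop K) (kop (kernel_comm d K)).
Proof.
move=> dK dB sab; have dC := kernel_comm_dominated dK dB sab.
have E := kernel_commE dK dB sab.
split; last 1 first.
- move=> [x w] /= [y [z [/= /mulopE xy /mulopE xz ->]]].
  apply: seq_of_inj; apply/funext => l.
  by rewrite /= seq_ofB xz (E x y xy l) [X in X - _]addrC addrK.
- move=> x [y /mulopE xy]; exists (kop K y + kop (kernel_comm d K) x).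
  by apply/mulopE => l; rewrite seq_ofD -(E x y xy).
- exact: kop_bounded dC.
Qed.

(** Each commutator replaces [alpha] by [alpha * beta]. Since [(1 + beta)^k] dominates all lower
    powers of [beta], a single summability condition covers every order up to [k] and passes through
    the induction. *)
Lemma kop_in_dom_ad (d : G -> R[i]) k K alpha beta : dominated K alpha ->
  (forall m, 0 <= beta m) ->
  (forall l m, normc (d l - d (l - m)) <= beta m) ->
  rsummable (fun m => alpha m * (1 + beta m) ^+ k) ->
  in_dom_ad k (mulop d) (kop K).
Proof.
move=> + b0 dB; elim: k K alpha => [|k ih] K alpha dK s /=; first exact: kop_bounded dK.
have a0 m := dominated_ge0 m dK.
split; first exact: kop_bounded dK.
have b1 m : 1 <= 1 + beta m by rewrite lerDl.
have pk m j : 1 <= (1 + beta m) ^+ j by rewrite exprn_ege1.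
have s1 : rsummable (fun m => alpha m * beta m * (1 + beta m) ^+ k).
  apply: rsummable_le s => m; rewrite ger0_norm ?mulr_ge0 ?exprn_ge0 ?addr_ge0//.
  rewrite exprS mulrA ler_wpM2r ?exprn_ge0 ?addr_ge0// ler_wpM2l// lerDr//.
have sab : rsummable (fun m => alpha m * beta m).
  apply: rsummable_le s1 => m; rewrite ger0_norm ?mulr_ge0//.
  by rewrite ler_peMr// mulr_ge0.
exists (kop (kernel_comm d K)); split; first exact: kop_commutator_ext dK dB sab.
by apply: ih s1; exact: kernel_comm_dominated.
Qed.

End KernelOperators.

(** * Unbounded operators *)

Section MultiplicationOperators.
Context {R : realType} {I : choiceType}.
Implicit Types (d : I -> R[i]) (x y : ell2 R I).

Lemma sqsummableD_le (f : I -> R[i]) x y :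
  (forall i, normc (f i) <= normc (seq_of x i) + normc (seq_of y i)) -> sqsummable f.
Proof.
move=> fxy.
apply: rsummable_le (rsummableZ 2 (rsummableD (ell2_sqsummable x) (ell2_sqsummable y))) => i.
rewrite ger0_norm ?sqr_ge0//.
apply: (@le_trans _ _ ((normc (seq_of x i) + normc (seq_of y i)) ^+ 2)).
  by rewrite ler_pXn2r ?nnegrE ?addr_ge0 ?normc_ge0.
have := sqr_ge0 (normc (seq_of x i) - normc (seq_of y i)).
rewrite sqrrB sqrrD !mulr2n; lra.
Qed.

Lemma mulop_is_operator d : is_operator (mulop d).
Proof.
split.
- by apply/mulopE => i; rewrite seq_of0 mulr0.
- move=> a x x' y y' /mulopE xy /mulopE x'y'; apply/mulopE => i.
  by rewrite !seq_ofL xy x'y'; ring.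
- move=> x y y' /mulopE xy /mulopE xy'; apply: seq_of_inj; apply/funext => i.
  by rewrite xy xy'.
Qed.

(** Finitely supported sequences lie in the domain however fast [d] grows. *)
Lemma mulop_densely_defined d : densely_defined (mulop d).
Proof.
move=> x e e0; have [F [finF hF]] := ell2_trunc x e0.
have sfin (h : I -> R[i]) : sqsummable (fun i => if i \in F then h i else 0).
  apply: (finite_support_rsummable finF) => i /negbTE ->.
  by rewrite Normc.normc0 expr0n.
pose y := mk_ell2 (sfin (seq_of x)).
pose z := mk_ell2 (sfin (fun i => d i * seq_of x i)).
exists y; split; last exact: hF.
by exists z; apply/mulopE => i; rewrite !mk_ell2E; case: ifP => _; rewrite ?mulr0.
Qed.

(** Basis vectors lie in the domain, and testing the adjoint relation on them determines every
    coordinate; hence the adjoint has no larger domain than the conjugate multiplication. *)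
Lemma mulop_adj d : uop_adj (mulop d) = mulop (fun i => (d i)^*%C).
Proof.
apply/seteqP; split=> -[g h].
  move=> adj; apply/mulopE => i; apply: (can_inj (@conjcK R)).
  rewrite rmorphM /= conjcK.
  have := adj (ell2_delta i) (d i *: ell2_delta i).
  rewrite (innerZl ell2_hilbert) !inner_delta => -> //.
  apply/mulopE => j; rewrite seq_ofZ ell2_deltaE; have [->//|ji] := eqVneq j i.
  by rewrite !mulr0.
move=> /mulopE gh x y /mulopE xy; rewrite !ell2_innerE; congr csum; apply/funext => i.
by rewrite xy gh rmorphM /= conjcK; ring.
Qed.

(** Cancellation in [d + d'] could make the domain on the right larger than the intersection of the
    two domains; the hypothesis excludes this. *)
Lemma mulop_add d d' : (forall i, normc (d i) <= normc (d i + d' i)) ->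
  uop_add (mulop d) (mulop d') = mulop (fun i => d i + d' i).
Proof.
move=> dd'; apply/seteqP; split=> -[x w].
  move=> [y [z [/mulopE xy /mulopE xz /= ->]]]; apply/mulopE => i.
  by rewrite seq_ofD xy xz mulrDl.
move=> /mulopE xw; have sy : sqsummable (fun i => d i * seq_of x i).
  apply: (@sqsummable_le _ _ _ w 1) => i; rewrite mul1r xw !Normc.normcM.
  by rewrite ler_wpM2r// normc_ge0.
exists (mk_ell2 sy), (w - mk_ell2 sy); split.
- by apply/mulopE.
- apply/mulopE => i; rewrite seq_ofB xw mk_ell2E.
  by rewrite mulrDl addrAC subrr add0r.
- by rewrite /= addrC subrK.
Qed.

(** For [a = 0] the right side is defined everywhere, the left side only on the domain of
    [mulop d]. *)
Lemma mulop_scale (a : R[i]) d : a != 0 ->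
  uop_scale a (mulop d) = mulop (fun i => a * d i).
Proof.
move=> a0; apply/seteqP; split=> -[x w].
  move=> [y [/mulopE xy /= ->]]; apply/mulopE => i; rewrite seq_ofZ xy.
  by rewrite mulrA.
move=> /mulopE xw; exists (a^-1 *: w); split; last by rewrite scalerA mulfV// scale1r.
by apply/mulopE => i; rewrite seq_ofZ xw -mulrA mulKf.
Qed.

(** The hypothesis puts the domain of the product symbol inside that of [d']; otherwise this could
    fail, for instance where [d] vanishes. *)
Lemma mulop_comp d d' : (forall i, normc (d' i) <= 1 + normc (d i * d' i)) ->
  uop_comp (mulop d) (mulop d') = mulop (fun i => d i * d' i).
Proof.
move=> dd'; apply/seteqP; split=> -[x w].
  move=> [y [/mulopE xy /mulopE yw]]; apply/mulopE => i.
  by rewrite yw xy mulrA.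
move=> /mulopE xw; have sy : sqsummable (fun i => d' i * seq_of x i).
  apply: (@sqsummableD_le _ x w) => i; rewrite xw.
  rewrite [leLHS]Normc.normcM [in X in _ + X]Normc.normcM -[X in X + _]mul1r.
  by rewrite -mulrDl ler_wpM2r ?normc_ge0.
by exists (mk_ell2 sy); split; apply/mulopE => i //=; rewrite mk_ell2E xw mulrA.
Qed.

Lemma mulop_selfadjoint d : (forall i, (d i)^*%C = d i) -> selfadjoint (mulop d).
Proof.
move=> dr; split; [exact: mulop_is_operator|exact: mulop_densely_defined|].
by rewrite mulop_adj; congr mulop; apply/funext => i; rewrite dr.
Qed.

Lemma mulop_positive (d : I -> R) : (forall i, 0 <= d i) ->
  positive (mulop (fun i => (d i)%:C)).
Proof.
move=> d0 x y xy; rewrite (inner_real xy) ler0c rsum_ge0// => i.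
by rewrite mulr_ge0// sqr_ge0.
Qed.

End MultiplicationOperators.

(** * Block operators on the doubled Hilbert space *)

Section BlockOperators.
Context {R : realType} (H : ipSpace R) (hH : is_hilbert H).
Local Notation HH := (dsum H H).
Implicit Types (S T : uop H) (f g : H -> H).

Lemma dsum_scaleD (a : R[i]) (x y : HH) :
  a *: x + y = (a *: x.1 + y.1, a *: x.2 + y.2).
Proof. by []. Qed.

Lemma diag_is_operator S T : is_operator S -> is_operator T ->
  is_operator (uop_diag S T).
Proof.
move=> [S0 Sl Su] [T0 Tl Tu]; split.
- by split.
- move=> a x x' y y' [/= s1 t1] [/= s2 t2]; split=> /=; [exact: Sl|exact: Tl].
- move=> [x1 x2] [y1 y2] [z1 z2] [/= s1 t1] [/= s2 t2].
  by rewrite (Su _ _ _ s1 s2) (Tu _ _ _ t1 t2).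
Qed.

Lemma offdiag_is_operator S T : is_operator S -> is_operator T ->
  is_operator (uop_offdiag S T).
Proof.
move=> [S0 Sl Su] [T0 Tl Tu]; split.
- by split.
- move=> a x x' y y' [/= s1 t1] [/= s2 t2]; split=> /=; [exact: Sl|exact: Tl].
- move=> [x1 x2] [y1 y2] [z1 z2] [/= s1 t1] [/= s2 t2].
  by rewrite (Su _ _ _ s1 s2) (Tu _ _ _ t1 t2).
Qed.

Lemma diag_densely_defined S T : densely_defined S -> densely_defined T ->
  densely_defined (uop_diag S T).
Proof.
move=> Sd Td [x1 x2] e e0; have e2 : 0 < e / 2 by rewrite divr_gt0.
have [y1 [[z1 h1] n1]] := Sd x1 _ e2; have [y2 [[z2 h2] n2]] := Td x2 _ e2.
exists (y1, y2); split; first by exists (z1, z2).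
by rewrite (le_lt_trans (dsum_hnorm_le hH hH _))// [e]splitr ltrD.
Qed.

Lemma offdiag_densely_defined S T : densely_defined S -> densely_defined T ->
  densely_defined (uop_offdiag S T).
Proof.
move=> Sd Td [x1 x2] e e0; have e2 : 0 < e / 2 by rewrite divr_gt0.
have [y1 [[z1 h1] n1]] := Td x1 _ e2; have [y2 [[z2 h2] n2]] := Sd x2 _ e2.
exists (y1, y2); split; first by exists (z2, z1).
by rewrite (le_lt_trans (dsum_hnorm_le hH hH _))// [e]splitr ltrD.
Qed.

Lemma diag_adj S T : S (0, 0) -> T (0, 0) ->
  uop_adj (uop_diag S T) = uop_diag (uop_adj S) (uop_adj T).
Proof.
move=> S0 T0; apply/seteqP; split=> -[[g1 g2] [h1 h2]] /=.
  move=> adj; split=> /= x y xy.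
    have := adj (x, 0) (y, 0) (conj xy T0).
    by rewrite !dsum_innerE /= !inner0l// !addr0.
  have := adj (0, x) (0, y) (conj S0 xy).
  by rewrite !dsum_innerE /= !inner0l// !add0r.
move=> [/= a1 a2] [x1 x2] [y1 y2] [/= s t].
by have /= -> := a1 _ _ s; have /= -> := a2 _ _ t.
Qed.

Lemma offdiag_adj S T : S (0, 0) -> T (0, 0) ->
  uop_adj (uop_offdiag S T) = uop_offdiag (uop_adj T) (uop_adj S).
Proof.
move=> S0 T0; apply/seteqP; split=> -[[g1 g2] [h1 h2]] /=.
  move=> adj; split=> /= x y xy.
    have := adj (x, 0) (0, y) (conj S0 xy).
    by rewrite !dsum_innerE /= !inner0l// !addr0 !add0r.
  have := adj (0, x) (y, 0) (conj xy T0).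
  by rewrite !dsum_innerE /= !inner0l// !addr0 !add0r.
move=> [/= a1 a2] [x1 x2] [y1 y2] [/= s t].
by have /= -> := a2 _ _ s; have /= -> := a1 _ _ t; rewrite addrC.
Qed.

Lemma diag_comp S T S' T' : uop_comp (uop_diag S T) (uop_diag S' T') =
  uop_diag (uop_comp S S') (uop_comp T T').
Proof.
apply/seteqP; split=> -[[x1 x2] [z1 z2]] /=.
  by move=> [[y1 y2] [[/= a b] [/= c e]]]; split=> /=; [exists y1|exists y2].
move=> [[/= y1 [a c]] [/= y2 [b e]]].
by exists (y1, y2).
Qed.

Lemma offdiag_comp S T S' T' : uop_comp (uop_offdiag S T) (uop_offdiag S' T') =
  uop_diag (uop_comp S T') (uop_comp T S').
Proof.
apply/seteqP; split=> -[[x1 x2] [z1 z2]] /=.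
  by move=> [[y1 y2] [[/= a b] [/= c e]]]; split=> /=; [exists y2|exists y1].
move=> [[/= y2 [b c]] [/= y1 [a e]]].
by exists (y1, y2).
Qed.

Lemma diag_selfadjoint S : selfadjoint S -> selfadjoint (uop_diag S S).
Proof.
move=> [oS dS aS]; split; [exact: diag_is_operator|exact: diag_densely_defined|].
by have [S0 _ _] := oS; rewrite diag_adj// aS.
Qed.

Lemma offdiag_selfadjoint S T : is_operator S -> is_operator T ->
  densely_defined S -> densely_defined T -> uop_adj S = T -> uop_adj T = S ->
  selfadjoint (uop_offdiag S T).
Proof.
move=> oS oT dS dT aS aT.
split; [exact: offdiag_is_operator|exact: offdiag_densely_defined|].
by have [S0 _ _] := oS; have [T0 _ _] := oT; rewrite offdiag_adj// aS aT.
Qed.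

Lemma diag_positive S T : positive S -> positive T -> positive (uop_diag S T).
Proof.
by move=> pS pT [x1 x2] [y1 y2] [/= s t]; apply: addr_ge0;
  [exact: pS|exact: pT].
Qed.

Definition block_diag f g : HH -> HH := fun x => (f x.1, g x.2).
Definition block_offdiag f g : HH -> HH := fun x => (f x.2, g x.1).

Lemma block_diag_bounded f g : bounded_op f -> bounded_op g ->
  bounded_op (block_diag f g).
Proof.
move=> bf bg; split.
  move=> a x y; rewrite /block_diag dsum_scaleD /=.
  by rewrite (proj1 bf) (proj1 bg).
have [M [M0 hM]] := bounded_op_ge0 bf; have [N [N0 hN]] := bounded_op_ge0 bg.
exists (M + N) => x; rewrite (le_trans (dsum_hnorm_le hH hH _))//= mulrDl lerD//.
  by rewrite (le_trans (hM _))// ler_wpM2l// dsum_hnorm1.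
by rewrite (le_trans (hN _))// ler_wpM2l// dsum_hnorm2.
Qed.

Lemma block_offdiag_bounded f g : bounded_op f -> bounded_op g ->
  bounded_op (block_offdiag f g).
Proof.
move=> bf bg; split.
  move=> a x y; rewrite /block_offdiag dsum_scaleD /=.
  by rewrite (proj1 bf) (proj1 bg).
have [M [M0 hM]] := bounded_op_ge0 bf; have [N [N0 hN]] := bounded_op_ge0 bg.
exists (M + N) => x; rewrite (le_trans (dsum_hnorm_le hH hH _))//= mulrDl lerD//.
  by rewrite (le_trans (hM _))// ler_wpM2l// dsum_hnorm2.
by rewrite (le_trans (hN _))// ler_wpM2l// dsum_hnorm1.
Qed.

Lemma diag_commutator_ext S T f1 f2 g1 g2 : commutator_ext S f1 g1 ->
  commutator_ext T f2 g2 ->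
  commutator_ext (uop_diag S T) (block_diag f1 f2) (block_diag g1 g2).
Proof.
move=> [p1 b1 c1] [p2 b2 c2]; split.
- move=> [x1 x2] [[y1 y2] [/= s t]].
  have [z1 h1] := p1 x1 (ex_intro _ y1 s); have [z2 h2] := p2 x2 (ex_intro _ y2 t).
  by exists (z1, z2).
- exact: block_diag_bounded.
- move=> [[x1 x2] w] [[y1 y2] [[z1 z2] [[/= s1 t1] [/= s2 t2] /= ->]]].
  have /= h1 := c1 (x1, z1 - f1 y1) (ex_intro _ y1 (ex_intro _ z1 (And3 s1 s2 erefl))).
  have /= h2 := c2 (x2, z2 - f2 y2) (ex_intro _ y2 (ex_intro _ z2 (And3 t1 t2 erefl))).
  exact: (congr2 (@pair H H) h1 h2).
Qed.

(** With the same [f] in both diagonal entries the corners are [S f - f S] and [T f - f T], which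
    are genuine commutators. *)
Lemma offdiag_commutator_ext S T f g1 g2 : commutator_ext S f g1 ->
  commutator_ext T f g2 ->
  commutator_ext (uop_offdiag S T) (block_diag f f) (block_offdiag g1 g2).
Proof.
move=> [p1 b1 c1] [p2 b2 c2]; split.
- move=> [x1 x2] [[y1 y2] [/= s t]].
  have [z1 h1] := p1 x2 (ex_intro _ y1 s); have [z2 h2] := p2 x1 (ex_intro _ y2 t).
  by exists (z1, z2).
- exact: block_offdiag_bounded.
- move=> [[x1 x2] w] [[y1 y2] [[z1 z2] [[/= s1 t1] [/= s2 t2] /= ->]]].
  have /= h1 := c1 (x2, z1 - f y1) (ex_intro _ y1 (ex_intro _ z1 (And3 s1 s2 erefl))).
  have /= h2 := c2 (x1, z2 - f y2) (ex_intro _ y2 (ex_intro _ z2 (And3 t1 t2 erefl))).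
  exact: (congr2 (@pair H H) h1 h2).
Qed.

(** [[D, a]] is off-diagonal, so commutators with [|D|] must be iterated on off-diagonal operators
    too; equal diagonal entries [T] make each corner an ordinary commutator. *)
Lemma diag_commutator_ext_offdiag T f1 f2 g1 g2 : commutator_ext T f1 g1 ->
  commutator_ext T f2 g2 ->
  commutator_ext (uop_diag T T) (block_offdiag f1 f2) (block_offdiag g1 g2).
Proof.
move=> [p1 b1 c1] [p2 b2 c2]; split.
- move=> [x1 x2] [[y1 y2] [/= s t]].
  have [z1 h1] := p1 x2 (ex_intro _ y2 t); have [z2 h2] := p2 x1 (ex_intro _ y1 s).
  by exists (z1, z2).
- exact: block_offdiag_bounded.
- move=> [[x1 x2] w] [[y1 y2] [[z1 z2] [[/= s1 t1] [/= s2 t2] /= ->]]].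
  have /= h1 := c1 (x2, z1 - f1 y2) (ex_intro _ y2 (ex_intro _ z1 (And3 t1 s2 erefl))).
  have /= h2 := c2 (x1, z2 - f2 y1) (ex_intro _ y1 (ex_intro _ z2 (And3 s1 t2 erefl))).
  exact: (congr2 (@pair H H) h1 h2).
Qed.

Lemma block_diag_in_dom_ad k T f g : in_dom_ad k T f -> in_dom_ad k T g ->
  in_dom_ad k (uop_diag T T) (block_diag f g).
Proof.
elim: k f g => [|k ih] f g /=; first exact: block_diag_bounded.
move=> [bf [f' [cf af]]] [bg [g' [cg ag]]]; split; first exact: block_diag_bounded.
exists (block_diag f' g'); split; first exact: diag_commutator_ext.
exact: ih.
Qed.

Lemma block_offdiag_in_dom_ad k T f g : in_dom_ad k T f -> in_dom_ad k T g ->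
  in_dom_ad k (uop_diag T T) (block_offdiag f g).
Proof.
elim: k f g => [|k ih] f g /=; first exact: block_offdiag_bounded.
move=> [bf [f' [cf af]]] [bg [g' [cg ag]]]; split; first exact: block_offdiag_bounded.
exists (block_offdiag f' g'); split; first exact: diag_commutator_ext_offdiag.
exact: ih.
Qed.

Lemma compact_op_comp f g : bounded_op g -> compact_op f -> compact_op (g \o f).
Proof.
move=> bg cf u bu; have [s [l [ms hl]]] := cf u bu; exists s, (g l); split=> //.
have [M [M0 hM]] := bounded_op_ge0 bg.
move: hl; rewrite !seq_cvg0P; try by move=> ?; exact: hnorm_ge0.
move=> hl e e0; have M1 : 0 < M + 1 by rewrite ltr_wpDl.
have [N hN] := hl _ (divr_gt0 e0 M1); exists N => i Ni /=.
rewrite -(linear_mapB _ _ (proj1 bg)) (le_lt_trans (hM _))//.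
apply: (@le_lt_trans _ _ ((M + 1) * hnorm (f (u (s i)) - l))).
  by rewrite ler_wpM2r ?hnorm_ge0// lerDl.
by rewrite mulrC -ltr_pdivlMr// hN.
Qed.

Lemma homo_ltn_ge (s : nat -> nat) : (forall i j, (i < j)%N -> (s i < s j)%N) ->
  forall i, (i <= s i)%N.
Proof.
move=> ms; elim=> // i ih; exact: (leq_ltn_trans ih (ms _ _ (ltnSn i))).
Qed.

(** A second extraction, inside the subsequence found for the first component, makes both components
    converge. *)
Lemma compact_op_diag f : compact_op f -> compact_op (diag_rep f).
Proof.
move=> cf u [M bu].
have [s [l1 [ms h1]]] := cf (fun i => (u i).1) (ex_intro _ M
  (fun i => le_trans (dsum_hnorm1 hH hH (u i)) (bu i))).
have [t [l2 [mt h2]]] := cf (fun i => (u (s i)).2) (ex_intro _ M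
  (fun i => le_trans (dsum_hnorm2 hH hH (u (s i))) (bu (s i)))).
exists (s \o t), (l1, l2); split; first by move=> i j ij /=; exact/ms/mt.
move: h1 h2; rewrite !seq_cvg0P; try by move=> ?; exact: hnorm_ge0.
move=> h1 h2 e e0; have e2 : 0 < e / 2 by rewrite divr_gt0.
have [N1 hN1] := h1 _ e2; have [N2 hN2] := h2 _ e2.
exists (maxn N1 N2) => i; rewrite geq_max => /andP[i1 i2].
rewrite (le_lt_trans (dsum_hnorm_le hH hH _))// [e]splitr ltrD//=.
  exact/hN1/(leq_trans i1)/homo_ltn_ge.
exact: hN2.
Qed.

Lemma diag_star_representation (A : set (H -> H)) : A `<=` @bounded_op R H ->
  star_representation A (@diag_rep R H).
Proof.
move=> Ab; split=> //.
- by move=> f /Ab bf; exact: (block_diag_bounded bf bf).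
- move=> f g _ _ fg x y; rewrite !dsum_innerE /=.
  by rewrite !fg.
Qed.

Lemma diag_resolvent_sqrt (D : uop HH) Q f : bounded_op f -> positive (uop_of f) ->
  uop_comp D D = uop_diag Q Q ->
  uop_of (f \o f) = uop_inv (uop_add (uop_of id) Q) ->
  resolvent_sqrt D (diag_rep f).
Proof.
move=> bf pf DQ ff; split; first exact: (block_diag_bounded bf bf).
- move=> [x1 x2] [y1 y2] [/= -> ->]; by apply: addr_ge0; exact: pf.
rewrite DQ; apply/seteqP; split=> -[[x1 x2] [y1 y2]] /=.
  move=> [e1 e2].
  have h x y : y = f (f x) -> exists z, Q (y, z) /\ x = y + z.
    move=> e; have : uop_of (f \o f) (x, y) by [].
    rewrite ff => -[a [z [ay Qz xE]]]; exists z; split; first exact: Qz.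
    by have <- : a = y := ay; exact: xE.
  have [z1 [q1 x1E]] := h _ _ e1; have [z2 [q2 x2E]] := h _ _ e2.
  exists (y1, y2), (z1, z2); split=> //=.
  by rewrite {1}x1E {1}x2E.
move=> [[a1 a2] [[b1 b2] [e [/= q1 q2] [x1E x2E]]]].
have [e1 e2] : a1 = y1 /\ a2 = y2 by move: e => /= [-> ->].
have h x y a z : a = y -> Q (y, z) -> x = a + z -> y = f (f x).
  move=> -> Qz xE; have : uop_inv (uop_add (uop_of id) Q) (x, y) by exists y, z.
  by rewrite -ff.
by rewrite /uop_of /= /diag_rep /= -(h _ _ _ _ e1 q1 x1E) -(h _ _ _ _ e2 q2 x2E).
Qed.

End BlockOperators.

(** * Compactness *)

Section CompactOperators.
Context {R : realType}.

(** The image of [U] has a cluster point [p] in a compact segment. Either the indices with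
    [|a i - p| < e / 2] form a set of [U], or their complement does, and the latter contradicts
    clustering. *)
Lemma ultra_bounded_cauchy (U : set_system nat) (a : nat -> R) (M e : R) :
  UltraFilter U -> (forall i, `|a i| <= M) -> 0 < e ->
  exists2 J, U J & forall i j, J i -> J j -> `|a i - a j| < e.
Proof.
move=> UU aM e0.
have [] := @segment_compact R (- M) M (a @ U).
  have aU : U (a @^-1` `[- M, M]).
    by apply: (filterS _ (@filterT _ U _)) => i _; rewrite /= in_itv /= -ler_norml.
  exact: aU.
move=> p [_ cp]; have e2 : 0 < e / 2 by rewrite divr_gt0.
pose J := [set i | `|a i - p| < e / 2].
exists J; last first.
  move=> i j iJ jJ; rewrite -(subrKA p) (le_lt_trans (ler_normD _ _))//.
  by rewrite [e]splitr ltrD// distrC.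
have [//|UJ] := in_ultra_setVsetC J UU.
have [] := cp [set x | ~ `|x - p| < e / 2] [set x | `|x - p| < e / 2] UJ.
  apply/nbhs_ballP; exists (e / 2) => // x.
  by rewrite /ball /= distrC.
by move=> x [].
Qed.

(* If [J p] is a set of the ultrafilter on which [f o u] varies by less than
   [1/(p+1)], a subsequence with [s p] in [J 0, ..., J p] is Cauchy. *)
Lemma compact_op_ultra (H : ipSpace R) (f : H -> H) : is_hilbert H ->
  (forall u : nat -> H, (exists M : R, forall i, hnorm (u i) <= M) ->
   forall U : set_system nat, UltraFilter U -> forall e : R, 0 < e ->
   exists2 J, U J & forall i j, J i -> J j -> hnorm (f (u i) - f (u j)) < e) ->
  compact_op f.
Proof.
(* [U] refines the filter at infinity, so each of its sets contains arbitrarily large indices and a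
   subsequence can be chosen in it. *)
move=> hH hf u bu; have [U [UU leU]] := ultraFilterLemma eventually_filter.
have /choice[J hJ] : forall p : nat, exists J, U J /\
    forall i j, J i -> J j -> hnorm (f (u i) - f (u j)) < p.+1%:R^-1.
  by move=> p; have [|J UJ hJ] := hf u bu U UU (p.+1%:R^-1); [rewrite invr_gt0|exists J].
have UK p : U [set i | forall q, (q <= p)%N -> J q i].
  elim: p => [|p ih].
    apply: filterS (hJ 0%N).1 => i Ji q; by rewrite leqn0 => /eqP ->.
  apply: filterS2 ih (hJ p.+1).1 => i h1 h2 q.
  by rewrite leq_eqVlt => /predU1P[->//|]; rewrite ltnS => /h1.
have /choice[h hh] : forall pn : nat * nat, exists i, (pn.2 < i)%N /\
    forall q, (q <= pn.1)%N -> J q i.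
  move=> [p n]; have Un : U [set i | (n < i)%N].
    by apply: leU; exists n.+1.
  by have [i [h1 h2]] := filter_ex (filterI Un (UK p)); exists i.
pose s := fix s p := if p is p'.+1 then h (p, s p') else h (0%N, 0%N).
have sJ p q : (q <= p)%N -> J q (s p).
  by case: p => [|p] /=; [exact: (hh (0%N, 0%N)).2|exact: (hh (p.+1, s p)).2].
have sS p : (s p < s p.+1)%N by exact: (hh (p.+1, s p)).1.
have ms i j : (i < j)%N -> (s i < s j)%N.
  elim: j => // j ih; rewrite ltnS leq_eqVlt => /predU1P[->//|/ih].
  by move=> /ltn_trans; apply.
have [l hl] : exists l, hnorm (f (u (s i)) - l) @[i --> \oo] --> (0 : R).
  case: hH => _ _ _ _; apply => e e0; have [N hN] := ltr_invS e0.
  exists N => i j Ni Nj; apply: lt_trans hN.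
  by apply: (hJ N).2; exact: sJ.
by exists s, l.
Qed.

End CompactOperators.

Section DiagonalOperators.
Context {R : realType} {G : zmodType}.
Context (r : G -> R) (r0 : forall l, 0 <= r l) (r1 : forall l, r l <= 1).
(* Multiplication by [r] is the kernel operator supported on [m = 0]. *)
Local Notation dkernel := (fun l m : G => if m == 0 then (r l)%:C else 0).

Lemma dkernel_dominated : dominated dkernel (fun m => (m == 0)%:R : R).
Proof.
split.
  by apply: (@rsum_single R G _ 0 _).1 => m /negbTE ->.
move=> l m; case: ifP => _; last by rewrite Normc.normc0.
by rewrite normc_real ger0_norm.
Qed.

Definition diagonal_op : ell2 R G -> ell2 R G := kop dkernel.

Lemma diagonal_opE x l : seq_of (diagonal_op x) l = (r l)%:C * seq_of x l.
Proof.
rewrite /diagonal_op (kopE x dkernel_dominated) /kconv (@csum_single R G _ 0).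
  by rewrite eqxx subr0.
by move=> m /negbTE ->; rewrite mul0r.
Qed.

Lemma diagonal_op_bounded : bounded_op diagonal_op.
Proof. exact: kop_bounded dkernel_dominated. Qed.

Lemma diagonal_op_positive : positive (uop_of diagonal_op).
Proof.
move=> x y yE; have {}yE : y = diagonal_op x := yE.
have := @inner_real R G x y r; rewrite yE => ->; last exact: diagonal_opE.
by rewrite ler0c rsum_ge0// => l; rewrite mulr_ge0// sqr_ge0.
Qed.

Lemma rsum_finite_support (F : set G) (f : G -> R) : finite_set F ->
  (forall i, 0 <= f i) -> (forall i, i \notin F -> f i = 0) ->
  rsum f = \sum_(i \in F) f i.
Proof.
move=> finF f0 h; apply: (@EFin_inj R).
rewrite -rsummable_esum//; last exact: finite_support_rsummable h.
have -> : (\esum_(x in [set: G]) (f x)%:E = \esum_(x in F) (f x)%:E)%E.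
  by rewrite [RHS]esum_mkcond; apply: eq_esum => i _ /=; case: ifPn => // /h ->.
by rewrite esum_fset ?fsumEFin// => i _; rewrite lee_fin.
Qed.

Lemma ultra_coords_cauchy (u : nat -> ell2 R G) (M : R) (U : set_system nat)
  (s : seq G) : (forall i, hnorm (u i) <= M) -> UltraFilter U ->
  forall e : R, 0 < e -> exists2 J, U J & forall i j, J i -> J j ->
    \sum_(l <- s) normc (seq_of (u i) l - seq_of (u j) l) ^+ 2 < e.
Proof.
move=> uM UU; elim: s => [|l s ih] e e0.
  by exists setT => [|i j _ _]; [exact: filterT|rewrite big_nil].
have e2 : 0 < e / 2 by rewrite divr_gt0.
have [J UJ hJ] := ih _ e2.
(* The final halving shares the bound between real and imaginary parts; the minimum with [1] takes
   care of the square. *)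
have m0 : 0 < Num.min 1 (e / 2) / 2 by rewrite divr_gt0// lt_min ltr01.
have bRe i : `|complex.Re (seq_of (u i) l)| <= M.
  by rewrite (le_trans (normc_Re _))// (le_trans (ell2_coord _ _)).
have bIm i : `|complex.Im (seq_of (u i) l)| <= M.
  by rewrite (le_trans (normc_Im _))// (le_trans (ell2_coord _ _)).
have [J1 UJ1 hJ1] := ultra_bounded_cauchy UU bRe m0.
have [J2 UJ2 hJ2] := ultra_bounded_cauchy UU bIm m0.
exists (J `&` (J1 `&` J2)); first by do 2 apply: filterI => //.
move=> i j [Ji [J1i J2i]] [Jj [J1j J2j]]; rewrite big_cons [e]splitr ltrD ?hJ//.
have : normc (seq_of (u i) l - seq_of (u j) l) < Num.min 1 (e / 2).
  rewrite (le_lt_trans (normc_le_ReIm _))// [ltRHS]splitr ltrD//.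
    have := hJ1 i j J1i J1j.
    by case: (seq_of (u i) l) => ? ?; case: (seq_of (u j) l).
  have := hJ2 i j J2i J2j.
  by case: (seq_of (u i) l) => ? ?; case: (seq_of (u j) l).
rewrite lt_min => /andP[l1 l2]; rewrite (le_lt_trans _ l2)//.
by rewrite expr2 ler_piMr ?normc_ge0// ltW.
Qed.

(** The finitely many coordinates with [r] at least [eta] are controlled by the ultrafilter; on all
    others the factor [r < eta] makes the contribution of a bounded sequence small. *)
Lemma diagonal_op_compact : (forall e, 0 < e -> finite_set [set l | e <= r l]) ->
  compact_op diagonal_op.
Proof.
move=> fin; apply: compact_op_ultra; first exact: ell2_hilbert.
move=> u [M uM] U UU e e0.
have M0 : 0 <= M := le_trans (hnorm_ge0 _) (uM 0%N).
have M1 : 0 < 4 * (M + 1) by rewrite mulr_gt0// ltr_wpDl.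
(* Differences of the sequence have norm at most [2 * M], so [eta] times such a norm is at most
   [e / 2]. *)
pose eta := e / (4 * (M + 1)); have eta0 : 0 < eta by rewrite divr_gt0.
pose F := [set l | eta <= r l]; have finF : finite_set F by exact: fin.
have d0 : 0 < e ^+ 2 / 4 by rewrite divr_gt0// exprn_gt0.
have [J UJ hJ] := ultra_coords_cauchy (finmap.enum_fset (fset_set F)) uM UU d0.
exists J => // i j Ji Jj; have := hJ i j Ji Jj.
rewrite -(linear_mapB _ _ (proj1 diagonal_op_bounded)); set w := u i - u j => hw.
have wM : hnorm w <= 2 * M.
  by rewrite (le_trans (hnormB ell2_hilbert _ _))// mulr2n mulrDl !mul1r lerD.
rewrite -(@ltr_pXn2r R 2) ?nnegrE ?hnorm_ge0 ?(ltW e0)// ell2_hnorm_sq.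
pose g1 l := eta ^+ 2 * normc (seq_of w l) ^+ 2.
pose g2 l := if l \in F then normc (seq_of w l) ^+ 2 else 0.
have g20 l : 0 <= g2 l by rewrite /g2; case: ifP => // _; rewrite sqr_ge0.
have g2F l : l \notin F -> g2 l = 0 by rewrite /g2 => /negbTE ->.
have s1 : rsummable g1 by exact: rsummableZ (ell2_sqsummable w).
have s2 : rsummable g2 by exact: finite_support_rsummable g2F.
have E2 : rsum g2 < e ^+ 2 / 4.
  rewrite (rsum_finite_support finF g20 g2F) fsbig_finite//= (le_lt_trans _ hw)//.
  rewrite [leLHS]big_seq [leRHS]big_seq; apply: ler_sum => l lF.
  by rewrite /g2; case: ifP => // _; rewrite sqr_ge0.
have E1 : rsum g1 <= e ^+ 2 / 4.
  rewrite rsumZ; last exact: ell2_sqsummable.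
  rewrite -ell2_hnorm_sq -exprMn (_ : e ^+ 2 / 4 = (e / 2) ^+ 2); last by field.
  have h2 : 0 <= e / 2 by rewrite divr_ge0// ltW.
  have h1 : 0 <= eta * hnorm w by rewrite mulr_ge0 ?hnorm_ge0// ltW.
  rewrite ler_pXn2r ?nnegrE// (le_trans (ler_wpM2l (ltW eta0) wM))//.
  by rewrite /eta mulrAC ler_pdivrMr//; nra.
apply: (@le_lt_trans _ _ (rsum g1 + rsum g2)); last by have := exprn_gt0 2 e0; lra.
rewrite -rsumD//; apply: rsum_le; [exact: ell2_sqsummable|exact: rsummableD|].
move=> l; rewrite diagonal_opE Normc.normcM exprMn normc_real ger0_norm//.
have n0 : 0 <= normc (seq_of w l) ^+ 2 by exact: sqr_ge0.
rewrite /g1 /g2; case: ifPn => lF.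
  apply: ler_wpDl; first by rewrite mulr_ge0// sqr_ge0.
  by rewrite ler_piMl// exprn_ile1.
rewrite addr0 ler_wpM2r// ler_pXn2r ?nnegrE// ?(ltW eta0)//.
by rewrite leNgt; apply: contra lF => h; rewrite inE /F /= ltW.
Qed.

End DiagonalOperators.

(** * The square root of the resolvent *)

Section Resolvent.
Context {R : realType} {G : zmodType}.
Context (q : G -> R) (q0 : forall l, 0 <= q l).
Let r l : R := (Num.sqrt (1 + q l))^-1.

Lemma resolvent_symbol_ge0 l : 0 <= r l.
Proof. by rewrite invr_ge0 sqrtr_ge0. Qed.

Lemma resolvent_symbol_le1 l : r l <= 1.
Proof.
rewrite invf_le1 ?sqrtr_gt0 ?ltr_pwDl//.
by rewrite -[leLHS]sqrtr1 ler_sqrt ?lerDl// addr_ge0.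
Qed.

Lemma resolvent_symbol_sq l : r l ^+ 2 * (1 + q l) = 1.
Proof.
have p : 0 < 1 + q l by rewrite ltr_pwDl.
by rewrite exprVn sqr_sqrtr ?(ltW p)// mulVf// gt_eqF.
Qed.

Definition resolvent_op : ell2 R G -> ell2 R G := diagonal_op r.

Lemma resolvent_op_sq : uop_of (resolvent_op \o resolvent_op) =
  uop_inv (uop_add (uop_of id) (mulop (fun l => (q l)%:C))).
Proof.
have r0 := resolvent_symbol_ge0; have r1 := resolvent_symbol_le1.
have E x l : seq_of (resolvent_op (resolvent_op x)) l = (r l ^+ 2)%:C * seq_of x l.
  by rewrite !(diagonal_opE r0 r1) mulrA -rmorphM.
apply/seteqP; split=> -[x y].
  move=> yE; have {}yE : y = resolvent_op (resolvent_op x) := yE.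
  (* Multiplying [y] by [q] gives [x - y], because [q * r^2 = 1 - r^2]; in particular [y] lies in
     the domain of that multiplication. *)
  exists y, (x - y); split=> //=; last by rewrite addrC subrK.
  apply/mulopE => l; rewrite seq_ofB yE E mulrA -rmorphM /=.
  have -> : q l * r l ^+ 2 = 1 - r l ^+ 2.
    by have := resolvent_symbol_sq l; rewrite mulrDr mulr1 mulrC => <-; ring.
  by rewrite rmorphB /= mulrBl mul1r.
move=> [a [b [ay /mulopE yb xE]]].
have {}ay : a = y := ay; have {}xE : x = y + b by rewrite -ay; exact: xE.
apply: seq_of_inj; apply/funext => l; rewrite [RHS]E xE seq_ofD yb.
rewrite -{1}[seq_of y l]mul1r -(rmorph1 (real_complex R)) -(resolvent_symbol_sq l).
by rewrite rmorphM rmorphD rmorph1 /=; ring.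
Qed.

End Resolvent.

(** * Twisted convolution *)

Section TwistedConvolution.
Context {R : realType} (L : zmodClosed (R * R)%type).
Local Notation Lambda := (lattice_point L).
Implicit Types (a b : Lambda -> R[i]) (l m p : Lambda).

Lemma expiD (s t : R) : expi (s + t) = expi s * expi t.
Proof. by rewrite /expi cosD sinD; simpc; congr (_ +i* _); ring. Qed.

Lemma expi0 : expi (0 : R) = 1.
Proof. by rewrite /expi cos0 sin0. Qed.

Lemma expiN (t : R) : expi (- t) = (expi t)^*%C.
Proof. by rewrite /expi cosN sinN. Qed.

Lemma normc_expi (t : R) : normc (expi t) = 1.
Proof. by rewrite /expi /= cos2Dsin2 sqrtr1. Qed.

(** Additivity in each argument makes [cocycle] a bicharacter, from which the 2-cocycle identity
    behind the associativity of [tconv] follows. *)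
Lemma cocycleDl l l' m : cocycle (l + l') m = cocycle l m * cocycle l' m.
Proof.
rewrite /cocycle -expiD; congr expi.
have -> : (val (l + l')).1 = (val l).1 + (val l').1 by [].
by ring.
Qed.

Lemma cocycleDr l m m' : cocycle l (m + m') = cocycle l m * cocycle l m'.
Proof.
rewrite /cocycle -expiD; congr expi.
have -> : (val (m + m')).2 = (val m).2 + (val m').2 by [].
by ring.
Qed.

Lemma cocycleNl l m : cocycle (- l) m = (cocycle l m)^*%C.
Proof.
rewrite /cocycle -expiN; congr expi.
have -> : (val (- l)).1 = - (val l).1 by [].
by ring.
Qed.

Lemma cocycle0r l : cocycle l 0 = 1.
Proof.
rewrite /cocycle -[RHS]expi0; congr expi.
have -> : (val (0 : Lambda)).2 = 0 by [].
by ring.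
Qed.

Lemma normc_cocycle l m : normc (cocycle l m) = 1.
Proof. exact: normc_expi. Qed.

Definition conv_kernel a l m := a m * cocycle m (l - m).

Lemma conv_kernel_dominated a : csummable a ->
  dominated (conv_kernel a) (fun m => normc (a m)).
Proof.
by move=> sa; split=> // l m; rewrite Normc.normcM normc_cocycle mulr1.
Qed.

Lemma tconvE a b : tconv a b = kconv (conv_kernel a) b.
Proof.
apply/funext => l; congr csum; apply/funext => m.
by rewrite /conv_kernel mulrAC.
Qed.

Lemma lconvE a : lconv a = kop (conv_kernel a).
Proof. by apply/funext => f; rewrite kopEinsubd -tconvE. Qed.

Lemma lconv_opnorm a : csummable a ->
  opnorm_le (lconv a) (rsum (fun m => normc (a m))).
Proof.
by move=> sa; rewrite lconvE; exact: kop_opnorm (conv_kernel_dominated sa).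
Qed.

Lemma lconv_bounded a : csummable a -> bounded_op (lconv a).
Proof. by move=> sa; rewrite lconvE; exact: kop_bounded (conv_kernel_dominated sa). Qed.

Lemma lconv_linear (c : R[i]) a b : csummable a -> csummable b ->
  lconv (c *: a + b) = (fun f => c *: lconv a f + lconv b f).
Proof.
move=> sa sb; rewrite !lconvE.
rewrite -(kop_linl c (conv_kernel_dominated sa) (conv_kernel_dominated sb)).
congr kop; apply/funext => l; apply/funext => m.
rewrite /conv_kernel; have -> : (c *: a + b) m = c * a m + b m by [].
by ring.
Qed.

(** The factor [c(m, m)] of the involution and the factor [c(m, l - m)] of the kernel multiply to
    [c(m, l)], the conjugate of [c(-m, l)], as the adjoint kernel requires. *)
Lemma lconv_adjoint a : csummable a -> csummable (tstar a) ->
  adjoint_of (lconv a) (lconv (tstar a)).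
Proof.
move=> sa sa'; rewrite !lconvE.
apply: (kop_adjoint (conv_kernel_dominated sa) (conv_kernel_dominated sa')) => l m.
rewrite /conv_kernel /tstar opprK subrK conjcM cocycleNl conjcK.
by rewrite mulrAC mulrC -cocycleDr addrC subrK.
Qed.

(** The delta at [0] is the unit of twisted convolution, so an element can be recovered from its
    operator; this gives faithfulness. *)
Lemma lconv_delta a l : csummable a -> seq_of (lconv a (ell2_delta 0)) l = a l.
Proof.
move=> sa; rewrite lconvE (kopE _ (conv_kernel_dominated sa)) /kconv.
rewrite (@csum_single R Lambda _ l).
  by rewrite ell2_deltaE subrr eqxx mulr1 /conv_kernel subrr cocycle0r mulr1.
move=> m ml; rewrite ell2_deltaE subr_eq0 eq_sym (negbTE ml).
by rewrite mulr0.
Qed.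

Lemma lconv_inj a b : csummable a -> csummable b -> lconv a = lconv b -> a = b.
Proof.
by move=> sa sb e; apply/funext => l; rewrite -(lconv_delta l sa) e lconv_delta.
Qed.

(* Fubini and the cocycle identity
   c(p, m - p) c(m, l - m) = c(p, l - p) c(m - p, l - m). *)
Lemma lconv_tconv a b : csummable a -> csummable b -> csummable (tconv a b) ->
  lconv (tconv a b) = lconv a \o lconv b.
Proof.
move=> sa sb sab.
have da := conv_kernel_dominated sa; have db := conv_kernel_dominated sb.
apply/funext => f; apply: seq_of_inj; apply/funext => l.
rewrite /= !lconvE (kopE f (conv_kernel_dominated sab)) (kopE (kop _ f) da) (kopE f db).
pose X m p := a p * b (m - p) * seq_of f (l - m) * (cocycle p (m - p) * cocycle m (l - m)).
have [s2 _] := rsummable2_conv (fun i => normc_ge0 _) (fun i => normc_ge0 _) sa sb.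
have sX : csummable2 X.
  apply: rsummable2_le (rsummable2Z (hnorm f) s2) => m p.
  rewrite ger0_norm ?normc_ge0// /X !Normc.normcM !normc_cocycle !mulr1.
  by rewrite [leRHS]mulrC ler_wpM2l ?mulr_ge0 ?normc_ge0// ell2_coord.
transitivity (csum (fun m => csum (X m))).
  congr csum; apply/funext => m; rewrite /conv_kernel tconvE /kconv.
  rewrite -mulrA mulrC -csumZ; last first.
    apply: csummable_le (rsummable2_row m s2) => p.
    by rewrite !Normc.normcM normc_cocycle mulr1.
  by congr csum; apply/funext => p; rewrite /X /conv_kernel; ring.
rewrite csum_swap//; congr csum; apply/funext => p.
rewrite /kconv -csumZ; last exact: kop_csummable db.
rewrite -(reindex_csum (fun m => X m p) (addr_bij p)).
congr csum; apply/funext => m.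
rewrite /X /conv_kernel addrK opprD addrA (addrAC l (- m)).
have -> : cocycle p m * cocycle (m + p) (l - p - m) =
    cocycle p (l - p) * cocycle m (l - p - m).
  by rewrite cocycleDl mulrA mulrAC -cocycleDr addrC subrK mulrC.
by ring.
Qed.

End TwistedConvolution.

(** * The weighted twisted convolution algebras *)

Section WeightedAlgebra.
Context {R : realType} (L : zmodClosed (R * R)%type).
Local Notation Lambda := (lattice_point L).
Implicit Types (a b : Lambda -> R[i]) (l m p : Lambda) (n : nat).

Lemma weight_ge1 l : 1 <= weight l.
Proof.
rewrite -[leLHS]sqrtr1 ler_sqrt ?addr_ge0 ?sqr_ge0//.
by rewrite -addrA lerDl addr_ge0 ?sqr_ge0.
Qed.

Lemma weight_ge0 l : 0 <= weight l. Proof. exact: sqrtr_ge0. Qed.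

Lemma weight_sq l : weight l ^+ 2 = 1 + (val l).1 ^+ 2 + (val l).2 ^+ 2.
Proof. by rewrite sqr_sqrtr// !addr_ge0 ?sqr_ge0. Qed.

Lemma weightN l : weight (- l) = weight l.
Proof.
rewrite /weight; have -> : val (- l) = - val l by [].
by rewrite /= !sqrrN.
Qed.

(** From [|x + y|^2 <= 2 |x|^2 + 2 |y|^2]. The constant only enters as the factor [2 ^+ n] in the
    bound for [tconv]. *)
Lemma weight_submult l m : weight l <= 2 * (weight m * weight (l - m)).
Proof.
rewrite -(@ler_pXn2r R 2) ?nnegrE ?mulr_ge0 ?weight_ge0// !exprMn !weight_sq.
have -> : val l = val m + val (l - m) by rewrite -[LHS](congr1 val (subrK m l)) addrC.
case: (val m) => x1 x2; case: (val (l - m)) => y1 y2 /=.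
have := sqr_ge0 (x1 - y1); have := sqr_ge0 (x2 - y2).
have := mulr_ge0 (sqr_ge0 x1) (sqr_ge0 y1); have := mulr_ge0 (sqr_ge0 x1) (sqr_ge0 y2).
have := mulr_ge0 (sqr_ge0 x2) (sqr_ge0 y1); have := mulr_ge0 (sqr_ge0 x2) (sqr_ge0 y2).
have := sqr_ge0 x1; have := sqr_ge0 x2; have := sqr_ge0 y1; have := sqr_ge0 y2.
by rewrite !expr2; lra.
Qed.

Definition wnorm n a l : R := normc (a l) * weight l ^+ n.

Lemma wnorm_ge0 n a l : 0 <= wnorm n a l.
Proof. by rewrite mulr_ge0 ?normc_ge0 ?exprn_ge0 ?weight_ge0. Qed.

Lemma wnorm_ge n a l : normc (a l) <= wnorm n a l.
Proof. by rewrite ler_peMr ?normc_ge0// exprn_ege1// weight_ge1. Qed.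

Lemma ell1wP n a : ell1w L n a <-> rsummable (wnorm n a).
Proof.
have e : (\esum_(l in [set: Lambda]) (normc (a l) * weight l ^+ n)%:E =
   \esum_(l in [set: Lambda]) `|(EFin \o wnorm n a) l|)%E.
  by apply: eq_esum => l _ /=; rewrite ger0_norm ?wnorm_ge0.
rewrite /ell1w /= e; split=> [[]//|s]; split=> //; apply/ell1P.
by apply: csummable_le s => l; exact: wnorm_ge.
Qed.

Lemma ell1w_csummable n a : ell1w L n a -> csummable a.
Proof. by move=> [/ell1P]. Qed.

Lemma ell1w_ell1 n : ell1w L n `<=` ell1 R Lambda.
Proof. by move=> a []. Qed.

(** Makes the results on weighted algebras cover [ell1] as the exponent [0]. *)
Lemma ell1w0 : ell1w L 0 = ell1 R Lambda.
Proof.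
apply/seteqP; split; first exact: ell1w_ell1.
move=> a /ell1P sa; apply/ell1wP; apply: rsummable_le sa => l.
by rewrite ger0_norm ?wnorm_ge0// /wnorm expr0 mulr1.
Qed.

Lemma ell1w_0 n : ell1w L n 0.
Proof.
apply/ell1wP; have -> : wnorm n 0 = fun _ => 0.
  by apply/funext => l; rewrite /wnorm [X in X * _]Normc.normc0 mul0r.
by rewrite /rsummable /summable esum1 ?ltry// => i _ /=; rewrite normr0.
Qed.

Lemma ell1w_linear n (c : R[i]) a b : ell1w L n a -> ell1w L n b ->
  ell1w L n (c *: a + b).
Proof.
move=> /ell1wP sa /ell1wP sb; apply/ell1wP.
apply: rsummable_le (rsummableD (rsummableZ (normc c) sa) sb) => l.
rewrite ger0_norm ?wnorm_ge0// /wnorm mulrA -mulrDl ler_wpM2r ?exprn_ge0 ?weight_ge0//.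
by rewrite (le_trans (le_normcD _ _))// Normc.normcM.
Qed.

Lemma ell1w_tstar n a : ell1w L n a -> ell1w L n (tstar a).
Proof.
move=> /ell1wP sa; apply/ell1wP.
have -> : wnorm n (tstar a) = wnorm n a \o (fun l => - l).
  apply/funext => l; rewrite /wnorm /tstar /= Normc.normcM normc_cocycle mul1r.
  by rewrite normc_conj weightN.
exact: reindex_rsummable (@oppr_bij Lambda) sa.
Qed.

(** Submultiplicativity distributes the weight at [l] over the two factors, leaving an ordinary
    convolution of the summable families [wnorm n a] and [wnorm n b]. *)
Lemma ell1w_tconv n a b : ell1w L n a -> ell1w L n b -> ell1w L n (tconv a b).
Proof.
move=> sa sb; have [csa csb] := (ell1w_csummable sa, ell1w_csummable sb).
move: sa sb => /ell1wP sa /ell1wP sb; apply/ell1wP.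
have [s2 _] := rsummable2_conv (fun l => wnorm_ge0 n a l) (fun l => wnorm_ge0 n b l) sa sb.
have [s1 _] := rsummable2_conv (fun i => normc_ge0 _) (fun i => normc_ge0 _) csa csb.
have ge0 l m : 0 <= wnorm n a m * wnorm n b (l - m) by rewrite mulr_ge0 ?wnorm_ge0.
have [s _] := rsummable2_out ge0 s2.
apply: rsummable_le (rsummableZ (2 ^+ n) s) => l.
rewrite ger0_norm ?wnorm_ge0// /wnorm tconvE.
have sk : csummable (fun m => conv_kernel a l m * b (l - m)).
  apply: csummable_le (rsummable2_row l s1) => m.
  by rewrite !Normc.normcM normc_cocycle mulr1.
apply: (le_trans (ler_wpM2r (exprn_ge0 n (weight_ge0 l)) (normc_csum sk))).
rewrite mulrC -!rsumZ//; last exact: (rsummable2_row l s2).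
apply: rsum_le; [exact: rsummableZ|exact/rsummableZ/(rsummable2_row l s2)|].
move=> m; rewrite !Normc.normcM normc_cocycle mulr1 /wnorm.
rewrite [leRHS](_ : _ = (2 * (weight m * weight (l - m))) ^+ n *
  (normc (a m) * normc (b (l - m)))); last by rewrite !exprMn; ring.
rewrite ler_wpM2r ?mulr_ge0 ?normc_ge0// lerXn2r ?nnegrE ?mulr_ge0 ?weight_ge0//.
exact: weight_submult.
Qed.

Lemma lconv_ell1_sub : (@lconv R L) @` ell1 R Lambda `<=` @bounded_op R (ell2 R Lambda).
Proof. by move=> _ [a /ell1P sa <-]; exact: lconv_bounded. Qed.

Lemma lconv_ell1w_star_subalgebra n : star_subalgebra ((@lconv R L) @` ell1w L n).
Proof.
split.
- by move=> _ [a /ell1w_csummable sa <-]; exact: lconv_bounded.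
- exists 0; first exact: ell1w_0.
  have s0 := ell1w_csummable (ell1w_0 n).
  have := lconv_linear (-1) s0 s0; rewrite scaler0 add0r => ->.
  by apply/funext => f; rewrite scaleN1r addNr.
- move=> c _ _ [a sa <-] [b sb <-]; exists (c *: a + b); first exact: ell1w_linear.
  by rewrite lconv_linear//; exact: (@ell1w_csummable n).
- move=> _ _ [a sa <-] [b sb <-]; exists (tconv a b); first exact: ell1w_tconv.
  rewrite lconv_tconv//; try exact: (@ell1w_csummable n).
  exact: ell1w_csummable (ell1w_tconv sa sb).
- move=> _ [a sa <-]; exists (lconv (tstar a)); split.
    by exists (tstar a) => //; exact: ell1w_tstar.
  apply: lconv_adjoint; first exact: ell1w_csummable sa.
  exact: ell1w_csummable (ell1w_tstar sa).
Qed.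

Lemma twisted_cstar_cstar : cstar_algebra (twisted_cstar L).
Proof.
apply: op_closure_cstar; first exact: ell2_hilbert.
by rewrite -ell1w0; exact: lconv_ell1w_star_subalgebra.
Qed.

Lemma lconv_twisted_cstar n a : ell1w L n a -> twisted_cstar L (lconv a).
Proof.
move=> /ell1w_ell1 sa; apply: (op_closure_sub ell2_hilbert lconv_ell1_sub).
by exists a.
Qed.

(** Finitely supported sequences belong to [ell1w L n] for every [n], and the l^1 norm of the
    discarded tail bounds the operator norm of the error. *)
Lemma ell1w_dense n : twisted_cstar L `<=` op_closure ((@lconv R L) @` ell1w L n).
Proof.
apply: op_closureS; first exact: ell2_hilbert.
move=> _ [a /ell1P sa <-]; split; first exact: lconv_bounded.
move=> e e0; have [F [finF hF]] := rsum_tail sa (fun l => normc_ge0 _) e0.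
pose b l := if l \in F then a l else 0.
have sb : ell1w L n b.
  apply/ell1wP; apply: (finite_support_rsummable finF) => l /negbTE lF.
  by rewrite /wnorm /b lF Normc.normc0 mul0r.
have csb := ell1w_csummable sb.
exists (lconv b); split; first by exists b.
have sab : csummable (-1 *: b + a).
  exact: csummableD (csummableZ (-1) csb) sa.
move=> f; have := lconv_linear (-1) csb sa => E.
have -> : lconv a f - lconv b f = lconv (-1 *: b + a) f.
  by rewrite E scaleN1r addrC.
rewrite (le_trans (lconv_opnorm sab f))// ler_wpM2r ?hnorm_ge0//.
rewrite (le_trans _ (ltW hF))// le_eqVlt; apply/orP; left; apply/eqP.
congr rsum; apply/funext => l.
have -> : (-1 *: b + a) l = -1 * b l + a l by [].
by rewrite /b; case: ifP => _; rewrite ?mulr0 ?add0r// mulN1r addNr Normc.normc0.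
Qed.

Lemma ell1w_star_embedding n : star_embedding (@tconv R L) (@tstar R L) (ell1w L n)
  (twisted_cstar L) (@lconv R L).
Proof.
have cs := @ell1w_csummable n.
split; split.
- exact: ell1w_0.
- by move=> c a b; exact: ell1w_linear.
- by move=> a b; exact: ell1w_tconv.
- by move=> a; exact: ell1w_tstar.
- by move=> a; exact: lconv_twisted_cstar.
- by move=> c a b /cs sa /cs sb; exact: lconv_linear.
- move=> a b sa sb; have /cs sab := ell1w_tconv sa sb.
  by apply: lconv_tconv => //; exact: cs.
- by move=> a sa; have /cs sa' := ell1w_tstar sa; apply: lconv_adjoint => //; exact: cs.
- by move=> a b /cs sa /cs sb; exact: lconv_inj.
Qed.

End WeightedAlgebra.

(** * The Dirac operator *)

Section Lattice.
Context {R : realType} (L : zmodClosed (R * R)%type).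
Local Notation Lambda := (lattice_point L).
Implicit Types (a b : Lambda -> R[i]) (l m p : Lambda) (n : nat).

(** A gap around [0] separates any two lattice points uniformly, since their difference is again a
    lattice point. *)
Lemma lattice_separated : is_lattice L -> exists d : R, 0 < d /\
  forall l, `|(val l).1| < d -> `|(val l).2| < d -> l = 0.
Proof.
move=> [iso _]; have [_ [V nV VL]] := iso 0 (rpred0 _).
have [d /= d0 dV] := (nbhs_ballP _ _).1 nV.
exists d; split=> // l l1 l2; apply: val_inj.
have : (V `&` [set y | y \in L]) (val l).
  split; last exact: valP.
  by apply: dV; split; rewrite /ball /= sub0r normrN.
by rewrite VL.
Qed.

(* Points of the same cell of a fine enough grid coincide. *)
Lemma lattice_finite (C : R) : is_lattice L ->
  finite_set [set l : Lambda | `|(val l).1| <= C /\ `|(val l).2| <= C].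
Proof.
move=> /lattice_separated[d [d0 hd]].
pose cell (x : R) : nat := Num.truncn ((x + C) / d).
have cell_ge0 x : `|x| <= C -> 0 <= (x + C) / d.
  by move=> xC; rewrite divr_ge0 ?(ltW d0)// -lerBlDr sub0r; move: xC; rewrite ler_norml => /andP[].
have cell_inj x y : `|x| <= C -> `|y| <= C -> cell x = cell y -> `|x - y| < d.
  move=> xC yC xy.
  have /andP[x1 x2] := truncn_itv (cell_ge0 x xC).
  have /andP[y1 y2] := truncn_itv (cell_ge0 y yC).
  move: x1 x2 y1 y2; rewrite -/(cell x) -/(cell y) -xy -natr1 => x1 x2 y1 y2.
  have : `|(x + C) / d - (y + C) / d| < 1.
    by rewrite ltr_distl; apply/andP; split; lra.
  rewrite -mulrBl normrM normfV (gtr0_norm d0) ltr_pdivrMr// mul1r.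
  by rewrite opprD addrACA subrr addr0.
pose N := (Num.truncn ((C + C) / d)).+1.
have cellN x : `|x| <= C -> (cell x < N)%N.
  move=> xC; rewrite ltnS le_truncn// ler_wpM2r ?invr_ge0 ?(ltW d0)// lerD2r.
  exact: le_trans (ler_norm _) xC.
pose B := [set l : Lambda | `|(val l).1| <= C /\ `|(val l).2| <= C].
pose g l := (cell (val l).1, cell (val l).2).
have ginj : {in B &, injective g}.
  move=> l m; rewrite !inE => -[l1 l2] [m1 m2] [e1 e2].
  apply/eqP; rewrite -subr_eq0; apply/eqP/hd.
    by have -> : (val (l - m)).1 = (val l).1 - (val m).1 by []; exact: cell_inj.
  by have -> : (val (l - m)).2 = (val l).2 - (val m).2 by []; exact: cell_inj.
have gfin : finite_set (g @` B).
  apply: (@sub_finite_set _ _ (`I_N `*` `I_N)); last exact: finite_setX.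
  by move=> _ [l [l1 l2] <-]; split; exact: cellN.
(* A left inverse of [g] on [B], with default [0] off the image; it exhibits [B] inside the image of
   a finite set. *)
pose h k := xget 0 [set l | B l /\ g l = k].
apply: sub_finite_set (finite_image h gfin) => l Bl; exists (g l); first by exists l.
rewrite /h; case: xgetP => [m _ [Bm gm]|/(_ l)[]//].
by apply: ginj; rewrite ?inE.
Qed.

End Lattice.

Section DiracOperator.
Context {R : realType} (L : zmodClosed (R * R)%type).
Local Notation Lambda := (lattice_point L).
Local Notation H := (ell2 R Lambda).
Implicit Types (a : Lambda -> R[i]) (l m : Lambda) (n k : nat).

Definition radius l : R := 2 * pi * Num.sqrt ((val l).1 ^+ 2 + (val l).2 ^+ 2).

(* The symbol of the corner [d_1 + i d_2] of [D]. *)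
Definition dirac_symbol l : R[i] := - (2 * pi * (val l).2) +i* (2 * pi * (val l).1).

Lemma pi2_ge0 : 0 <= 2 * pi :> R.
Proof. by rewrite mulr_ge0// pi_ge0. Qed.

Lemma radius_ge0 l : 0 <= radius l.
Proof. by rewrite mulr_ge0 ?pi2_ge0 ?sqrtr_ge0. Qed.

Lemma normc_dirac_symbol l : normc (dirac_symbol l) = radius l.
Proof.
rewrite /dirac_symbol /radius /= sqrrN !exprMn -mulrDr addrC sqrtrM ?sqr_ge0//.
  by rewrite sqrtrM ?sqr_ge0// !sqrtr_sqr !ger0_norm ?pi_ge0.
by rewrite mulr_ge0 ?sqr_ge0.
Qed.

(** Unlike the symbol of [|D|], that of a corner of [D] is additive, so its commutator with
    [lconv a] has the kernel of convolution by the pointwise product of [dirac_symbol] and [a]. *)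
Lemma dirac_symbolB l m : dirac_symbol l - dirac_symbol (l - m) = dirac_symbol m.
Proof.
rewrite /dirac_symbol.
have -> : val (l - m) = val l - val m by [].
by rewrite /=; simpc; congr (_ +i* _); ring.
Qed.

Lemma dirac_symbolJB l m : (dirac_symbol l)^*%C - (dirac_symbol (l - m))^*%C =
  (dirac_symbol m)^*%C.
Proof. by rewrite -(dirac_symbolB l m) rmorphB. Qed.

(** The reverse triangle inequality of the plane, read in [R[i]] through [dirac_symbol], whose
    modulus is the radius. *)
Lemma radiusB l m : normc ((radius l)%:C - (radius (l - m))%:C) <= radius m.
Proof.
rewrite -rmorphB normc_real -!normc_dirac_symbol.
have h1 := le_normcD (dirac_symbol m) (dirac_symbol (l - m)).
rewrite -{1}(dirac_symbolB l m) subrK in h1.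
have h2 := le_normcD (dirac_symbol l) (- dirac_symbol m).
rewrite normcN in h2.
have e : dirac_symbol l - dirac_symbol m = dirac_symbol (l - m).
  by rewrite -[in LHS](dirac_symbolB l m) subKr.
rewrite e in h2.
by rewrite ler_norml; apply/andP; split; lra.
Qed.

Lemma radius_le_weight l : radius l <= 2 * pi * weight l.
Proof.
rewrite ler_wpM2l ?pi2_ge0// ler_sqrt ?addr_ge0 ?sqr_ge0//.
by rewrite -addrA lerDr.
Qed.

(** As the weight is at least [1], [1 + radius <= (1 + 2 pi) * weight]. This turns membership in
    [ell1w] into the summability that [kop_in_dom_ad] asks for. *)
Lemma ell1w_radius n k a : (k <= n)%N -> ell1w L n a ->
  rsummable (fun l => normc (a l) * (1 + radius l) ^+ k).
Proof.
move=> kn /ell1wP sa; apply: rsummable_le (rsummableZ ((1 + 2 * pi) ^+ k) sa) => l.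
have w0 := weight_ge0 l; have w1 := weight_ge1 l; have p0 := pi2_ge0.
rewrite ger0_norm ?mulr_ge0 ?normc_ge0 ?exprn_ge0 ?addr_ge0 ?radius_ge0//.
rewrite /wnorm mulrCA ler_wpM2l ?normc_ge0//.
apply: (@le_trans _ _ (((1 + 2 * pi) * weight l) ^+ k)).
  rewrite lerXn2r ?nnegrE ?mulr_ge0 ?addr_ge0 ?radius_ge0//.
  by rewrite mulrDl mul1r lerD// radius_le_weight.
by rewrite exprMn ler_wpM2l ?exprn_ge0 ?addr_ge0// ler_weXn2l.
Qed.

Lemma abs_symbolE : @abs_symbol R L = mulop (fun l : Lambda => (radius l)%:C).
Proof. by []. Qed.

Lemma dirac_opE : dirac_op L =
  uop_offdiag (mulop dirac_symbol) (mulop (fun l => (dirac_symbol l)^*%C)).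
Proof.
have i0 : 'i%C != 0 :> R[i] by rewrite eq_complex /= oner_eq0 andbF.
have n0 : -1 != 0 :> R[i] by rewrite oppr_eq0 oner_eq0.
have E1 l : 'i%C * (2 * pi * (val l).1)%:C + 'i%C * ('i%C * (2 * pi * (val l).2)%:C) =
    dirac_symbol l by rewrite /dirac_symbol; simpc.
have E2 l : -1 * ('i%C * (2 * pi * (val l).1)%:C) +
    'i%C * ('i%C * (2 * pi * (val l).2)%:C) = (dirac_symbol l)^*%C.
  by rewrite /dirac_symbol mulN1r; simpc.
(* The summands of a corner symbol are its imaginary and its real part, so they cannot cancel and
   [mulop_add] applies. *)
have le1 l : normc ('i%C * (2 * pi * (val l).1)%:C) <= normc (dirac_symbol l).
  rewrite /dirac_symbol; simpc.
  rewrite [leLHS]/= expr0n add0r [leRHS]/= ler_sqrt ?lerDr ?sqr_ge0//.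
  by rewrite addr_ge0 ?sqr_ge0.
rewrite /dirac_op /partial1 /partial2 !mulop_scale// !mulop_add.
- congr uop_offdiag; congr mulop; apply/funext => l; [exact: E1|exact: E2].
- by move=> l; rewrite E2 normc_conj mulN1r normcN.
- by move=> l; rewrite E1.
Qed.

Lemma dirac_symbol_sq l : dirac_symbol l * (dirac_symbol l)^*%C = (radius l ^+ 2)%:C.
Proof. by rewrite mulc_conj normc_dirac_symbol. Qed.

(** Provides the domain condition of [mulop_comp] for squares: the domain of multiplication by
    [|d|^2] lies in that of [d]. *)
Lemma le_1_sq (t : R) : t <= 1 + t * t.
Proof. have := sqr_ge0 (t - 1 / 2); rewrite expr2; nra. Qed.

Local Notation Q := (mulop (fun l : Lambda => (radius l ^+ 2)%:C)).

Lemma dirac_op_sq : uop_comp (dirac_op L) (dirac_op L) = uop_diag Q Q.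
Proof.
rewrite dirac_opE offdiag_comp !mulop_comp.
- congr uop_diag; congr mulop; apply/funext => l; rewrite -dirac_symbol_sq//.
  by rewrite mulrC.
- by move=> l; rewrite Normc.normcM normc_conj le_1_sq.
- by move=> l; rewrite Normc.normcM normc_conj le_1_sq.
Qed.

Lemma abs_dirac_op_sq : uop_comp (abs_dirac_op L) (abs_dirac_op L) = uop_diag Q Q.
Proof.
rewrite /abs_dirac_op abs_symbolE diag_comp !mulop_comp.
- by congr uop_diag; congr mulop; apply/funext => l; rewrite -rmorphM.
- by move=> l; rewrite Normc.normcM le_1_sq.
Qed.

Lemma abs_dirac_op_selfadjoint : selfadjoint (abs_dirac_op L).
Proof.
apply: (diag_selfadjoint ell2_hilbert); apply: mulop_selfadjoint => l.
exact: conjc_real.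
Qed.

Lemma dirac_op_selfadjoint : selfadjoint (dirac_op L).
Proof.
rewrite dirac_opE; apply: (offdiag_selfadjoint ell2_hilbert);
  [exact: mulop_is_operator|exact: mulop_is_operator|exact: mulop_densely_defined
  |exact: mulop_densely_defined|exact: mulop_adj|].
by rewrite mulop_adj; congr mulop; apply/funext => l; rewrite conjcK.
Qed.

Lemma abs_dirac_op_positive : positive (abs_dirac_op L).
Proof. by apply: diag_positive; apply: mulop_positive; exact: radius_ge0. Qed.

Lemma abs_value_dirac_op : abs_value (dirac_op L) (abs_dirac_op L).
Proof.
split; [exact: abs_dirac_op_selfadjoint|exact: abs_dirac_op_positive|].
by have [_ _ ->] := dirac_op_selfadjoint; rewrite dirac_op_sq abs_dirac_op_sq.
Qed.

Lemma abs_value_abs_dirac_op : abs_value (abs_dirac_op L) (abs_dirac_op L).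
Proof.
split; [exact: abs_dirac_op_selfadjoint|exact: abs_dirac_op_positive|].
by have [_ _ ->] := abs_dirac_op_selfadjoint.
Qed.

Lemma radius_sq_ge0 l : 0 <= radius l ^+ 2.
Proof. exact: sqr_ge0. Qed.

Definition lattice_resolvent : H -> H := resolvent_op (fun l => radius l ^+ 2).

(** [(1 + D^2)^(-1/2)] sees [D] only through its square, so one diagonal operator serves both [D]
    and [|D|]. *)
Lemma lattice_resolvent_sqrt (D : uop (dsum H H)) : uop_comp D D = uop_diag Q Q ->
  resolvent_sqrt D (diag_rep lattice_resolvent).
Proof.
move=> DQ.
have r0 := resolvent_symbol_ge0 (fun l => radius l ^+ 2).
have r1 := resolvent_symbol_le1 radius_sq_ge0.
apply: (diag_resolvent_sqrt ell2_hilbert _ _ DQ).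
- exact: diagonal_op_bounded.
- exact: diagonal_op_positive.
- exact: resolvent_op_sq radius_sq_ge0.
Qed.

Lemma lattice_resolvent_compact : is_lattice L -> compact_op lattice_resolvent.
Proof.
move=> hL; apply: diagonal_op_compact.
- exact: resolvent_symbol_ge0.
- exact: resolvent_symbol_le1 radius_sq_ge0.
move=> e e0; apply: sub_finite_set (lattice_finite e^-1 hL) => l /= el.
have s0 : 0 < Num.sqrt (1 + radius l ^+ 2) by rewrite sqrtr_gt0 ltr_pwDl// sqr_ge0.
have {}el : Num.sqrt (1 + radius l ^+ 2) <= e^-1.
  by rewrite -[leLHS]invrK lef_pV2 ?posrE ?invr_gt0.
(* The bound on [1 + (2 pi |l|)^2] passes to [|l|^2] by dropping the [1] and the factor [(2 pi)^2],
   which is at least [1]. *)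
have key : (val l).1 ^+ 2 + (val l).2 ^+ 2 <= e^-1 ^+ 2.
  have e10 : 0 <= e^-1 by rewrite invr_ge0 ltW.
  have := el; rewrite -(@ler_pXn2r R 2) ?nnegrE ?(ltW s0)//.
  rewrite sqr_sqrtr ?addr_ge0 ?sqr_ge0//; apply: le_trans.
  rewrite /radius exprMn sqr_sqrtr ?addr_ge0 ?sqr_ge0//.
  apply: ler_wpDl => //; rewrite ler_peMl ?addr_ge0 ?sqr_ge0// exprn_ege1//.
  by have := pi_ge2 R; lra.
have bnd (x : R) : x ^+ 2 <= e^-1 ^+ 2 -> `|x| <= e^-1.
  move=> h; rewrite -(@ler_pXn2r R 2) ?nnegrE ?invr_ge0 ?(ltW e0)//.
  by rewrite real_normK ?num_real.
by split; apply: bnd; apply: le_trans key; rewrite ?lerDl ?lerDr sqr_ge0.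
Qed.

Local Notation K := (conv_kernel (L := L)).

Lemma lconv_in_dom_ad n k a : (k <= n)%N -> ell1w L n a ->
  in_dom_ad k (@abs_symbol R L) (lconv a).
Proof.
move=> kn sa; rewrite lconvE abs_symbolE.
apply: (kop_in_dom_ad (conv_kernel_dominated (ell1w_csummable sa)) radius_ge0 radiusB).
exact: ell1w_radius sa.
Qed.

(** [z] stands for [dirac_symbol], its conjugate or the radius. The commutator with [z] uses one
    power of the weight and the [k] commutators with [|D|] the others, hence the strict
    inequality. *)
Lemma lconv_commutator n k a (z : Lambda -> R[i]) : (k < n)%N -> ell1w L n a ->
  (forall l m, normc (z l - z (l - m)) <= radius m) ->
  commutator_ext (mulop z) (lconv a) (kop (kernel_comm z (K a))) /\
    in_dom_ad k (@abs_symbol R L) (kop (kernel_comm z (K a))).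
Proof.
move=> kn sa zB; have da := conv_kernel_dominated (ell1w_csummable sa).
have r0 := radius_ge0; have n0 l := normc_ge0 (a l).
have s1 j : (j < n)%N -> rsummable (fun m => normc (a m) * radius m * (1 + radius m) ^+ j).
  move=> jn; apply: rsummable_le (ell1w_radius jn sa) => m.
  have p0 : 0 <= (1 + radius m) ^+ j by rewrite exprn_ge0 ?addr_ge0.
  rewrite ger0_norm; last by rewrite (mulr_ge0 _ p0)// mulr_ge0.
  by rewrite -mulrA exprS ler_wpM2l// ler_wpM2r ?exprn_ge0 ?addr_ge0// lerDr.
have s0 : rsummable (fun m => normc (a m) * radius m).
  have := s1 0%N (leq_ltn_trans (leq0n k) kn).
  by under eq_fun do rewrite expr0 mulr1.
split; first by rewrite lconvE; exact: (kop_commutator_ext da zB s0).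
rewrite abs_symbolE.
exact: (kop_in_dom_ad (kernel_comm_dominated da zB s0) radius_ge0 radiusB (s1 k kn)).
Qed.

Lemma dirac_commutator n k a : (k < n)%N -> ell1w L n a ->
  exists B, commutator_ext (dirac_op L) (diag_rep (lconv a)) B /\
    in_dom_ad k (abs_dirac_op L) B.
Proof.
move=> kn sa; rewrite dirac_opE.
have zB l m : normc (dirac_symbol l - dirac_symbol (l - m)) <= radius m.
  by rewrite dirac_symbolB normc_dirac_symbol.
have zJB l m : normc ((dirac_symbol l)^*%C - (dirac_symbol (l - m))^*%C) <= radius m.
  by rewrite dirac_symbolJB normc_conj normc_dirac_symbol.
have [c1 d1] := lconv_commutator kn sa zB.
have [c2 d2] := lconv_commutator kn sa zJB.
eexists; split; first exact: (offdiag_commutator_ext ell2_hilbert c1 c2).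
exact: (block_offdiag_in_dom_ad ell2_hilbert d1 d2).
Qed.

Lemma abs_dirac_commutator n k a : (k < n)%N -> ell1w L n a ->
  exists B, commutator_ext (abs_dirac_op L) (diag_rep (lconv a)) B /\
    in_dom_ad k (abs_dirac_op L) B.
Proof.
move=> kn sa; have [c d] := lconv_commutator kn sa radiusB.
eexists; split; first exact: (diag_commutator_ext ell2_hilbert c c).
exact: (block_diag_in_dom_ad ell2_hilbert d d).
Qed.

(** The argument common to [D] and [|D|]; the regularity of the first commutator, which is
    off-diagonal in one case and diagonal in the other, enters as a hypothesis. *)
Lemma lattice_quantum_C n k (D : uop (dsum H H)) : is_lattice L -> (k < n)%N ->
  selfadjoint D -> uop_comp D D = uop_diag Q Q -> abs_value D (abs_dirac_op L) ->
  (forall a, ell1w L n a ->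
    exists B, commutator_ext D (diag_rep (lconv a)) B /\
    in_dom_ad k (abs_dirac_op L) B) ->
  quantum_C_spectral_triple k (twisted_cstar L) (@diag_rep R H)
    ((@lconv R L) @` ell1w L n) D.
Proof.
move=> hL kn sD DQ absD comm; split; last first.
  exists (abs_dirac_op L); split=> // _ [a sa <-]; split; last exact: comm.
  have d := lconv_in_dom_ad (ltnW kn) sa.
  exact: (block_diag_in_dom_ad ell2_hilbert d d).
split; split.
- exact: ell2_hilbert.
- exact: twisted_cstar_cstar.
- exact: dsum_hilbert ell2_hilbert ell2_hilbert.
- by apply: (diag_star_representation ell2_hilbert) => f [].
- exact: lconv_ell1w_star_subalgebra.
- by move=> _ [a sa <-]; exact: lconv_twisted_cstar sa.
- exact: ell1w_dense.
- exact: sD.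
exists (diag_rep lattice_resolvent); split; first exact: lattice_resolvent_sqrt.
move=> _ [a sa <-]; split; first by have [B [cB _]] := comm a sa; exists B.
apply: (compact_op_diag ell2_hilbert (f := lconv a \o lattice_resolvent)).
apply: compact_op_comp; last exact: lattice_resolvent_compact.
exact: lconv_bounded (ell1w_csummable sa).
Qed.

End DiracOperator.

(** The first three conjuncts tie the concrete operators to the abstract objects: [lconv] represents
    both convolution algebras faithfully inside the twisted group algebra, and [abs_dirac_op] is the
    absolute value of [dirac_op]. *)
Theorem mainTheorem7 (R : realType) (L : zmodClosed (R * R)%type) (n k : nat)
    (hL : is_lattice L) (hnk : (k + 1 <= n)%N) :
  let A := twisted_cstar L in
  let calA := (@lconv R L) @` ell1w L n in
  let rep := @diag_rep R (ell2 R (lattice_point L)) in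
  [/\ star_embedding (@tconv R L) (@tstar R L) (ell1 R (lattice_point L)) A (@lconv R L),
      star_embedding (@tconv R L) (@tstar R L) (ell1w L n) A (@lconv R L),
      abs_value (dirac_op L) (abs_dirac_op L),
      quantum_C_spectral_triple k A rep calA (abs_dirac_op L) &
      quantum_C_spectral_triple k A rep calA (dirac_op L)].
Proof.
move=> A calA rep; have kn : (k < n)%N by rewrite -addn1.
split.
- by rewrite -ell1w0; exact: ell1w_star_embedding.
- exact: ell1w_star_embedding.
- exact: abs_value_dirac_op.
- apply: lattice_quantum_C => //; [exact: abs_dirac_op_selfadjoint|exact: abs_dirac_op_sq
    |exact: abs_value_abs_dirac_op|move=> a; exact: abs_dirac_commutator].
- apply: lattice_quantum_C => //; [exact: dirac_op_selfadjoint|exact: dirac_op_sq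
    |exact: abs_value_dirac_op|move=> a; exact: dirac_commutator].
Qed.
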